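(* Let $\mathcal{G}$ be a minimal, expansive, purely infinite, essentially principal, étale Cantor groupoid. Then the group $\mathsf{A}(\mathcal{G})$ is two-generated, i.e. it is generated by two of its elements.
   Context: A groupoid is a small category in which every morphism is invertible; $\mathcal{G}^{(0)}$ is its set of units, $s(\gamma)=\gamma^{-1}\gamma$, $r(\gamma)=\gamma\gamma^{-1}$. All topological groupoids are Hausdorff. A bisection is an open set $B\subseteq\mathcal{G}$ such that $s|_B$ and $r|_B$ are homeomorphisms onto open subsets of $\mathcal{G}^{(0)}$. $\mathcal{G}$ is étale if $s,r$ are local homeomorphisms; it is a Cantor groupoid if $\mathcal{G}^{(0)}$ is homeomorphic to the Cantor space. $\mathcal{G}$ is minimal if every orbit $\{r(\gamma): s(\gamma)=x\}$, $x\in\mathcal{G}^{(0)}$, is dense in $\mathcal{G}^{(0)}$. $\mathcal{G}$ is essentially principal if the set of $x\in\mathcal{G}^{(0)}$ with $\{\gamma: s(\gamma)=r(\gamma)=x\}=\{x\}$ is dense in $\mathcal{G}^{(0)}$. $\mathcal{G}$ is purely infinite if for every compact open $X\subseteq\mathcal{G}^{(0)}$ there are compact open bisections $B,B'$ with $s(B)=s(B')=X$ and with $r(B),r(B')$ disjoint and contained in $X$. Expansive: a compact set $K\subseteq\mathcal{G}$ is generating if $\mathcal{G}=\bigcup_{n\in\mathbb{N}}(K\cup K^{-1})^n$. A finite collection $\mathcal{B}$ of compact open bisections is expansive if $\bigcup_{n\in\mathbb{N}}(\mathcal{B}\cup\mathcal{B}^{-1})^n$ (the set of all products of elements of $\mathcal{B}\cup\mathcal{B}^{-1}$)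 is a basis for the topology of $\mathcal{G}$. $\mathcal{G}$ is expansive if there are a compact generating set $K$ and a finite cover $\mathcal{B}$ of $K$ by compact open bisections which is expansive. Topological full group: for a compact open bisection $B$ with $s(B)=r(B)=\mathcal{G}^{(0)}$ let $\alpha_B=r\circ(s|_B)^{-1}\in\mathrm{Homeo}(\mathcal{G}^{(0)})$; $\mathsf{F}(\mathcal{G})$ is the group of all such $\alpha_B$. The alternating group $\mathsf{A}(\mathcal{G})$ is the subgroup of $\mathsf{F}(\mathcal{G})$ generated by the elements $g$ of order three for which there are disjoint compact open sets $X_0,X_1,X_2\subseteq\mathcal{G}^{(0)}$ with $g(X_j)=X_{j+1}$ (indices mod 3) and $g$ the identity outside $X_0\sqcup X_1\sqcup X_2$. *)

(* Defs.v *)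
From HB Require Import structures.
From mathcomp Require Import all_boot.
From mathcomp Require Import all_classical topology cantor.

Set Implicit Arguments.
Unset Strict Implicit.
Unset Printing Implicit Defensive.

Local Open Scope classical_set_scope.
Local Open Scope group_scope.

(* Homeomorphisms are bundled with their inverse, so that [homeo X X] is a
   group under composition, (g * h) x = g (h x). *)
Record homeo (X Y : topologicalType) := Homeo {
  homeo_fun :> X -> Y;
  homeo_inv : Y -> X;
  homeo_funK : cancel homeo_fun homeo_inv;
  homeo_invK : cancel homeo_inv homeo_fun;
  homeo_fun_continuous : continuous homeo_fun;
  homeo_inv_continuous : continuous homeo_inv }.

HB.instance Definition _ (X Y : topologicalType) := gen_eqMixin (homeo X Y).
HB.instance Definition _ (X Y : topologicalType) := gen_choiceMixin (homeo X Y).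

Definition homeomorphic (X Y : topologicalType) : Prop := inhabited (homeo X Y).

Section HomeoGroup.
Variable X : topologicalType.
Implicit Types g h k : homeo X X.

Lemma homeo_ext g h : homeo_fun g =1 homeo_fun h -> g = h.
Proof.
case: g h => [f f' fK f'K cf cf'] [k k' kK k'K ck ck'] /= /funext efk.
have ef' : f' = k' by apply: funext => x; rewrite -{1}(k'K x) -efk fK.
case: _ / efk kK k'K ck; case: _ / ef' ck' => ? ? ? ?.
by congr Homeo; exact: Prop_irrelevance.
Qed.

Lemma comp_continuous (f g : X -> X) :
  continuous f -> continuous g -> continuous (f \o g).
Proof. by move=> cf cg x; apply: continuous_comp; [exact: cg | exact: cf]. Qed.

Definition homeo_one : homeo X X :=
  @Homeo X X id id (fun=> erefl) (fun=> erefl) (fun=> cvg_id) (fun=> cvg_id).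

Definition homeo_mul g h : homeo X X :=
  @Homeo X X (g \o h) (homeo_inv h \o homeo_inv g)
    (can_comp (homeo_funK g) (homeo_funK h))
    (can_comp (homeo_invK h) (homeo_invK g))
    (comp_continuous (@homeo_fun_continuous _ _ g)
                     (@homeo_fun_continuous _ _ h))
    (comp_continuous (@homeo_inv_continuous _ _ h)
                     (@homeo_inv_continuous _ _ g)).

Definition homeo_rev g : homeo X X :=
  @Homeo X X (homeo_inv g) g (homeo_invK g) (homeo_funK g)
    (@homeo_inv_continuous _ _ g) (@homeo_fun_continuous _ _ g).

Lemma homeo_mulA : associative homeo_mul.
Proof. by move=> g h k; exact: homeo_ext. Qed.
Lemma homeo_1mul : left_id homeo_one homeo_mul.
Proof. by move=> g; exact: homeo_ext. Qed.
Lemma homeo_mul1 : right_id homeo_one homeo_mul.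
Proof. by move=> g; exact: homeo_ext. Qed.
Lemma homeo_Vmul : left_inverse homeo_one homeo_rev homeo_mul.
Proof. by move=> g; apply: homeo_ext => x /=; rewrite homeo_funK. Qed.
Lemma homeo_mulV : right_inverse homeo_one homeo_rev homeo_mul.
Proof. by move=> g; apply: homeo_ext => x /=; rewrite homeo_invK. Qed.

HB.instance Definition _ := isGroup.Build (homeo X X)
  homeo_mulA homeo_1mul homeo_mul1 homeo_Vmul homeo_mulV.

End HomeoGroup.

Section Subgroups.
Variable gT : groupType.

Definition subgroup (H : set gT) : Prop :=
  [/\ H 1, (forall g h, H g -> H h -> H (g * h)) & (forall g, H g -> H g^-1)].

Definition subgroup_gen (S : set gT) : set gT := smallest subgroup S.

Definition has_order_three (g : gT) : Prop :=
  [/\ g != 1, g ^+ 2 != 1 & g ^+ 3 = 1].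

Definition two_generated (H : set gT) : Prop :=
  exists a b, [/\ H a, H b & subgroup_gen [set a; b] = H].

End Subgroups.

(* A groupoid is given by its set of arrows; an object is identified with its
   identity arrow, and [gdom x], [gcod x] are the identities at the source and
   at the range of [x]. The product [gmul x y] is meaningful only when
   [gdom x = gcod y]; its value on other pairs is junk. *)
HB.mixin Record isGroupoid G := {
  gdom : G -> G;
  gcod : G -> G;
  gmul : G -> G -> G;
  ginv : G -> G;
  gdom_dom : forall x, gdom (gdom x) = gdom x;
  gcod_dom : forall x, gcod (gdom x) = gdom x;
  gdom_cod : forall x, gdom (gcod x) = gcod x;
  gcod_cod : forall x, gcod (gcod x) = gcod x;
  gdom_mul : forall x y, gdom x = gcod y -> gdom (gmul x y) = gdom y;
  gcod_mul : forall x y, gdom x = gcod y -> gcod (gmul x y) = gcod x;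
  gmulA : forall x y z, gdom x = gcod y -> gdom y = gcod z ->
    gmul x (gmul y z) = gmul (gmul x y) z;
  gmul_dom : forall x, gmul x (gdom x) = x;
  gmul_cod : forall x, gmul (gcod x) x = x;
  gdom_inv : forall x, gdom (ginv x) = gcod x;
  gcod_inv : forall x, gcod (ginv x) = gdom x;
  gmulVx : forall x, gmul (ginv x) x = gdom x;
  gmulxV : forall x, gmul x (ginv x) = gcod x }.

#[short(type="groupoidType")]
HB.structure Definition Groupoid := {G of isGroupoid G}.

Definition composable (G : groupoidType) : set (G * G) :=
  [set p | gdom p.1 = gcod p.2].

HB.mixin Record isTopologicalGroupoid G of Groupoid G & Topological G := {
  gmul_continuous :
    continuous (fun p : @composable G => gmul (\val p).1 (\val p).2);
  ginv_continuous : continuous (@ginv G) }.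

#[short(type="topologicalGroupoidType")]
HB.structure Definition TopologicalGroupoid :=
  {G of Groupoid G & Topological G & isTopologicalGroupoid G}.

Section UnitSpace.
Variable G : groupoidType.

Definition units : set G := range (@gdom G).

Lemma units_dom (x : G) : gdom x \in units.
Proof. by rewrite inE; exists x. Qed.

Lemma units_cod (x : G) : gcod x \in units.
Proof. by rewrite inE; exists (gcod x) => //; exact: gdom_cod. Qed.

Definition src (x : G) : units := exist _ (gdom x) (units_dom x).
Definition rng (x : G) : units := exist _ (gcod x) (units_cod x).

Definition set_mul (A B : set G) : set G :=
  [set c | exists a b, [/\ A a, B b, gdom a = gcod b & c = gmul a b]].

Definition set_inv (A : set G) : set G := @ginv G @` A.

(* Exponents range over all of nat; the zeroth power is [units], the neutral
   element of [set_mul]. In an etale minimal Cantor groupoid, where all orbits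
   are infinite and no unit is isolated, restricting to positive exponents
   gives the same notions of generating set and of expansive family. *)
Fixpoint set_pow (A : set G) (n : nat) : set G :=
  if n is m.+1 then set_mul A (set_pow A m) else units.

Fixpoint family_pow (F : set (set G)) (n : nat) : set (set G) :=
  if n is m.+1 then [set set_mul A B | A in F & B in family_pow F m]
  else [set units].

End UnitSpace.
Arguments units G : clear implicits.

Section TopologicalGroupoids.
Variable G : topologicalGroupoidType.

(* Subsets, such as [units G], carry the subspace topology through the
   canonical instance on [set_type]. *)
Definition restricts_to_homeo (X Y : topologicalType) (f : X -> Y)
    (A : set X) (V : set Y) : Prop :=
  exists h : homeo A V, forall a : A, \val (h a) = f (\val a).

Definition local_homeomorphism (X Y : topologicalType) (f : X -> Y) : Prop :=
  forall x, exists A V, [/\ open A, A x, open V & restricts_to_homeo f A V].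

Definition etale : Prop :=
  local_homeomorphism (@src G) /\ local_homeomorphism (@rng G).

Definition bisection (B : set G) : Prop :=
  [/\ open B,
      (exists2 V, open V & restricts_to_homeo (@src G) B V) &
      (exists2 V, open V & restricts_to_homeo (@rng G) B V)].

Definition compact_open_bisection (B : set G) : Prop :=
  compact B /\ bisection B.

Definition cantor_groupoid : Prop := homeomorphic (units G) cantor_space.

Definition minimal : Prop :=
  forall x : units G, dense [set rng c | c in [set c : G | src c = x]].

Definition essentially_principal : Prop :=
  dense [set x : units G |
    [set c : G | src c = x /\ rng c = x] = [set \val x]].

Definition purely_infinite : Prop :=
  forall X : set (units G), compact X -> open X ->
    exists B B' : set G,
      [/\ compact_open_bisection B /\ compact_open_bisection B',
          @src G @` B = X /\ @src G @` B' = X,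
          (@rng G @` B) `&` (@rng G @` B') = set0,
          @rng G @` B `<=` X & @rng G @` B' `<=` X].

Definition generating (K : set G) : Prop :=
  \bigcup_n set_pow (K `|` set_inv K) n = [set: G].

Definition expansive_family (F : set (set G)) : Prop :=
  basis (\bigcup_n family_pow (F `|` (@set_inv G @` F)) n).

Definition expansive : Prop :=
  exists (K : set G) (F : set (set G)),
    [/\ compact K /\ generating K,
        finite_set F,
        F `<=` compact_open_bisection,
        K `<=` \bigcup_(B in F) B &
        expansive_family F].

(* alpha_B = r o (s|_B)^-1, where the partial inverse of s|_B is extended
   outside of s(B) by the inclusion of the unit space. *)
Definition alpha (B : set G) : units G -> units G :=
  @rng G \o 'pinv_(fun x : units G => \val x) B (@src G).

Definition full_group : set (homeo (units G) (units G)) :=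
  [set g | exists B : set G,
    [/\ compact_open_bisection B, @src G @` B = [set: units G],
        @rng G @` B = [set: units G] & homeo_fun g = alpha B]].

Definition three_cycle (g : homeo (units G) (units G)) : Prop :=
  [/\ full_group g, has_order_three g &
      exists X : 'I_3 -> set (units G),
        [/\ (forall j, compact (X j) /\ open (X j)),
            trivIset [set: 'I_3] X,
            (forall j, g @` X j = X (ordS j)) &
            (forall x, ~ (\bigcup_j X j) x -> g x = x)]].

Definition alternating_group : set (homeo (units G) (units G)) :=
  subgroup_gen three_cycle.

End TopologicalGroupoids.
Arguments etale G : clear implicits.
Arguments full_group G : clear implicits.
Arguments alternating_group G : clear implicits.

(* Main.v *)
(** A 3-cycle is carried by three disjoint embeddings f0, f1, f2 of a clopen set U
    by partial homeomorphisms of the groupoid, and two 3-cycles whose supports meet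
    only inside e(U) and e(V) have a 3-cycle over the intersection of U and V as
    their commutator.  Minimality and pure infiniteness embed any clopen set into
    any nonempty one, so 3-cycles supported in W move every proper clopen subset of
    W into any nonempty clopen subset of W; consequently, if a subgroup contains all
    3-cycles supported in W and all those supported in an overlapping W', then it
    contains all those supported in their union.

    Finite generation: put five disjoint copies e_i(X) of the unit space X into X,
    with union W.  Take the finitely many 3-cycles e_i x -> e_k (b x) -> e_l x over
    dom b, where b runs over the identity and the bisections of an expansive family
    and their inverses.  Commutators turn composition of bisections and intersection
    of domains into operations on 3-cycles, so by expansiveness these generate all
    3-cycles supported in W.  Moreover each of them is a commutator of two others.

    Two generators: choose a such that the translates a^i(W), i < K, are disjoint
    with K large, while a^K(W) and a^(K+1)(W) both meet W and the translates
    a^i(W), i <= K, cover X.  Let b be the product of the conjugates of the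
    generators f_i by a^(4^i).  Since the exponents 4^i form a Sidon set, the
    commutator of the conjugates of b by a^(-4^i) and a^(-4^j) is that of f_i and
    f_j.  Hence a and b generate all 3-cycles in W, then in the overlapping
    translates of W, and finally in X. *)

Require Import Defs.
From mathcomp Require Import all_boot.
From mathcomp Require Import all_classical topology cantor.
From mathcomp Require Import zify.

Set Implicit Arguments.
Unset Strict Implicit.
Unset Printing Implicit Defensive.

Local Open Scope classical_set_scope.
Local Open Scope group_scope.

(** * Evaluation of homeomorphisms and closure properties of subgroups *)

Section HomeoEval.
Variable X : topologicalType.
Implicit Types g h : homeo X X.

Lemma homeoM g h x : (g * h) x = g (h x). Proof. by []. Qed.
Lemma homeoVK g x : g^-1 (g x) = x. Proof. exact: homeo_funK. Qed.
Lemma homeoKV g x : g (g^-1 x) = x. Proof. exact: homeo_invK. Qed.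
Lemma homeoV_eq g x y : g x = y -> g^-1 y = x.
Proof. by move=> <-; rewrite homeoVK. Qed.
Lemma homeo_inj g : injective g.
Proof. exact: can_inj (homeoVK g). Qed.
Lemma homeoXS g n x : (g ^+ n.+1) x = g ((g ^+ n) x).
Proof. by rewrite expgS. Qed.
Lemma homeoXD g m n x : (g ^+ (m + n)) x = (g ^+ m) ((g ^+ n) x).
Proof. by rewrite expgnDr. Qed.
Lemma homeoXC g m n x : (g ^+ m) ((g ^+ n) x) = (g ^+ n) ((g ^+ m) x).
Proof. by rewrite -!homeoXD addnC. Qed.

End HomeoEval.

Section Subgroup.
Variables (gT : groupType) (N : set gT).
Hypothesis sN : subgroup N.

Lemma subgroup1 : N 1. Proof. by case: sN. Qed.
Lemma subgroupM g h : N g -> N h -> N (g * h).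
Proof. by case: sN => _ NM _; exact: NM. Qed.
Lemma subgroupV g : N g -> N g^-1.
Proof. by case: sN => _ _ NV; exact: NV. Qed.
Lemma subgroupX g n : N g -> N (g ^+ n).
Proof.
move=> Ng; elim: n => [|n IH]; first exact: subgroup1.
by rewrite expgS; apply: subgroupM.
Qed.
Lemma subgroup_conj g h : N g -> N h -> N (h * g * h^-1).
Proof.
by move=> Ng Nh; apply: subgroupM (subgroupV Nh); apply: subgroupM.
Qed.
Lemma subgroup_comm g h : N g -> N h -> N (g * h * g^-1 * h^-1).
Proof.
move=> Ng Nh; apply: subgroupM (subgroupV Nh).
by apply: subgroupM (subgroupV Ng); apply: subgroupM.
Qed.
End Subgroup.

Lemma subgroup_gen_subgroup (gT : groupType) (S : set gT) :
  subgroup (subgroup_gen S).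
Proof.
split; first by move=> N [[N1 _ _] _].
- by move=> g h gS hS N SN; apply: (subgroupM SN.1); [exact: gS SN|exact: hS SN].
- by move=> g gS N SN; apply: (subgroupV SN.1); exact: gS SN.
Qed.

(** * Calculus of 3-cycles *)

Section ThreeCycle.
Variable X : topologicalType.
Implicit Types (g h : homeo X X) (U V : set X) (f : X -> X).
Implicit Types N : set (homeo X X).

(* The base U only parametrizes the cycle: its support is the union of the three
   images f0(U), f1(U), f2(U) and need not contain U. *)
Definition is_cycle3 U f0 f1 f2 g : Prop :=
  [/\ forall x, U x -> g (f0 x) = f1 x,
      forall x, U x -> g (f1 x) = f2 x,
      forall x, U x -> g (f2 x) = f0 x &
      forall y, (forall x, U x -> [/\ y <> f0 x, y <> f1 x & y <> f2 x]) ->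
        g y = y].

Definition cycle3_in N U f0 f1 f2 : Prop :=
  exists2 g, N g & is_cycle3 U f0 f1 f2 g.

Definition disjoint3 U f0 f1 f2 : Prop := forall x y, U x -> U y ->
  [/\ f0 x = f0 y -> x = y, f1 x = f1 y -> x = y, f2 x = f2 y -> x = y &
      [/\ f0 x <> f1 y, f0 x <> f2 y & f1 x <> f2 y]].

Lemma support_cases U f0 f1 f2 y :
  (exists x, U x /\ [\/ y = f0 x, y = f1 x | y = f2 x]) \/
  (forall x, U x -> [/\ y <> f0 x, y <> f1 x & y <> f2 x]).
Proof.
have [yU|nU] := pselect (exists x, U x /\ [\/ y = f0 x, y = f1 x | y = f2 x]).
  by left.
by right=> x Ux; split=> yE; apply: nU; exists x; split=> //;
  [constructor 1|constructor 2|constructor 3].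
Qed.

Lemma is_cycle3_uniq U f0 f1 f2 g h :
  is_cycle3 U f0 f1 f2 g -> is_cycle3 U f0 f1 f2 h -> g = h.
Proof.
move=> [g0 g1 g2 gf] [h0 h1 h2 hf]; apply: homeo_ext => y.
have [[x [Ux [->|->|->]]]|yU] := support_cases U f0 f1 f2 y.
- by rewrite g0 // h0.
- by rewrite g1 // h1.
- by rewrite g2 // h2.
by rewrite gf // hf.
Qed.

Lemma is_cycle3_rot U f0 f1 f2 g :
  is_cycle3 U f0 f1 f2 g -> is_cycle3 U f1 f2 f0 g.
Proof.
by move=> [? ? ? gf]; split=> // y yU; apply: gf => x /yU[].
Qed.

Lemma is_cycle3_inv U f0 f1 f2 g :
  is_cycle3 U f0 f1 f2 g -> is_cycle3 U f1 f0 f2 g^-1.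
Proof.
move=> [g0 g1 g2 gf]; split=> [x Ux|x Ux|x Ux|y yU]; apply: homeoV_eq.
- exact: g0.
- exact: g2.
- exact: g1.
- by apply: gf => x /yU[].
Qed.

Lemma is_cycle3_conj U f0 f1 f2 g h :
  is_cycle3 U f0 f1 f2 g ->
  is_cycle3 U (h \o f0) (h \o f1) (h \o f2) (h * g * h^-1).
Proof.
move=> [g0 g1 g2 gf]; split=> [x Ux|x Ux|x Ux|y yU];
  rewrite !homeoM /comp ?homeoVK ?g0 ?g1 ?g2 // gf ?homeoKV // => x /yU[y0 y1 y2].
by split=> yE; [apply: y0|apply: y1|apply: y2]; rewrite /comp -yE homeoKV.
Qed.

(* As for permutations, where the commutator of (0 1 2) and (0 3 4) is a 3-cycle. *)
Lemma is_cycle3_comm U V e f1 f2 (h1 h2 : X -> X) g h :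
  is_cycle3 U e f1 f2 g -> is_cycle3 V e h1 h2 h ->
  (forall x y, U x -> V y -> [/\ e x = e y -> x = y, e x <> h1 y, e x <> h2 y,
    [/\ f1 x <> e y, f1 x <> h1 y & f1 x <> h2 y] &
    [/\ f2 x <> e y, f2 x <> h1 y & f2 x <> h2 y]]) ->
  is_cycle3 (U `&` V) e f1 h1 (g * h * g^-1 * h^-1).
Proof.
move=> cg ch sep.
have [g0 g1 g2 gf] := cg; have [g0' g1' g2' gf'] := is_cycle3_inv cg.
have [h0 k1 k2 hf] := ch; have [h0' h1' h2' hf'] := is_cycle3_inv ch.
have fix_e x : U x -> ~ V x -> forall y, V y -> [/\ e x <> e y, e x <> h1 y &
    e x <> h2 y].
  move=> Ux nVx y Vy; have [exy ? ? _ _] := sep _ _ Ux Vy.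
  by split=> // /exy xy; apply: nVx; rewrite xy.
have fix_f1 x : U x -> forall y, V y -> [/\ f1 x <> e y, f1 x <> h1 y &
    f1 x <> h2 y] by move=> Ux y Vy; case: (sep _ _ Ux Vy).
have fix_f2 x : U x -> forall y, V y -> [/\ f2 x <> e y, f2 x <> h1 y &
    f2 x <> h2 y] by move=> Ux y Vy; case: (sep _ _ Ux Vy).
have fix_e' y : V y -> ~ U y -> forall x, U x -> [/\ e y <> e x, e y <> f1 x &
    e y <> f2 x].
  move=> Vy nUy x Ux; have [exy _ _ [? _ _] [? _ _]] := sep _ _ Ux Vy.
  split; [|exact/nesym|exact/nesym] => /esym/exy xy.
  by apply: nUy; rewrite -xy.
have fix_h1 y : V y -> forall x, U x -> [/\ h1 y <> e x, h1 y <> f1 x &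
    h1 y <> f2 x].
  by move=> Vy x Ux; have [_ ? ? [_ ? _] [_ ? _]] := sep _ _ Ux Vy;
    split; exact/nesym.
have fix_h2 y : V y -> forall x, U x -> [/\ h2 y <> e x, h2 y <> f1 x &
    h2 y <> f2 x].
  by move=> Vy x Ux; have [_ ? ? [_ _ ?] [_ _ ?]] := sep _ _ Ux Vy;
    split; exact/nesym.
have swp (P0 P1 P2 : Prop) : [/\ P0, P1 & P2] -> [/\ P1, P0 & P2] by case.
split=> [x [Ux Vx]|x [Ux Vx]|x [Ux Vx]|y yUV]; rewrite !homeoM.
- rewrite h1' // gf'; first by rewrite k2 // g0.
  by move=> z Uz; apply/swp/fix_h2.
- rewrite hf'; last by move=> z Vz; apply/swp/fix_f1.
  by rewrite g0' // h0 // gf // => z Uz; exact: fix_h1.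
- rewrite h0' // g1' // hf; last by move=> z Vz; exact: fix_f2.
  exact: g2.
have [[x [Ux yx]]|yU] := support_cases U e f1 f2 y.
  case: yx => yE; subst y.
  - have nVx : ~ V x by move=> Vx; case: (yUV x).
    rewrite hf'; last by move=> z Vz; apply/swp/fix_e.
    rewrite g1' // hf; last by move=> z Vz; exact: fix_f2.
    exact: g2.
  - have nVx : ~ V x by move=> Vx; case: (yUV x).
    rewrite hf'; last by move=> z Vz; apply/swp/fix_f1.
    rewrite g0' // hf; last by move=> z Vz; exact: fix_e.
    exact: g0.
  - rewrite hf'; last by move=> z Vz; apply/swp/fix_f2.
    rewrite g2' // hf; last by move=> z Vz; exact: fix_f1.
    exact: g1.
have [[x [Vx yx]]|yV] := support_cases V e h1 h2 y.
  case: yx => yE; subst y.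
  - have nUx : ~ U x by move=> Ux; case: (yUV x).
    rewrite h1' // gf'; last by move=> z Uz; apply/swp/fix_h2.
    rewrite k2 // gf //.
  - have nUx : ~ U x by move=> Ux; case: (yUV x).
    rewrite h0' // gf'; last by move=> z Uz; apply/swp/fix_e'.
    rewrite h0 // gf //.
  - rewrite h2' // gf'; last by move=> z Uz; apply/swp/fix_h1.
    rewrite k1 // gf //.
rewrite hf'; last by move=> z /yV/swp.
by rewrite gf'; [rewrite hf // gf | move=> z /yU/swp].
Qed.

Lemma is_cycle3_mul U V f0 f1 f2 g h : U `&` V = set0 ->
  disjoint3 (U `|` V) f0 f1 f2 ->
  is_cycle3 U f0 f1 f2 g -> is_cycle3 V f0 f1 f2 h ->
  is_cycle3 (U `|` V) f0 f1 f2 (g * h).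
Proof.
move=> UV0 sep [g0 g1 g2 gf] [h0 h1 h2 hf].
have UV x y : U x -> V y -> x <> y.
  by move=> Ux Vy xy; rewrite -[False]/(set0 x) -UV0; split; rewrite // xy.
have s x y : U x -> V y -> [/\ [/\ f0 x <> f0 y, f0 x <> f1 y & f0 x <> f2 y],
    [/\ f1 x <> f0 y, f1 x <> f1 y & f1 x <> f2 y] &
    [/\ f2 x <> f0 y, f2 x <> f1 y & f2 x <> f2 y]].
  move=> Ux Vy; have nxy := UV _ _ Ux Vy.
  have [i0 i1 i2 [a b c]] := sep x y (or_introl Ux) (or_intror Vy).
  have [_ _ _ [a' b' c']] := sep y x (or_intror Vy) (or_introl Ux).
  by split; split=> // e; first [exact: nxy (i0 e)|exact: nxy (i1 e)
    |exact: nxy (i2 e)|exact: a' (esym e)|exact: b' (esym e)|exact: c' (esym e)].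
split=> [x [Ux|Vx]|x [Ux|Vx]|x [Ux|Vx]|y yUV]; rewrite !homeoM.
- by rewrite hf ?g0 // => y /(s _ _ Ux)[].
- by rewrite h0 // gf // => y Uy; have [[? ? ?] [? ? ?] [? ? ?]] := s _ _ Uy Vx;
    split; exact/nesym.
- by rewrite hf ?g1 // => y /(s _ _ Ux)[].
- by rewrite h1 // gf // => y Uy; have [[? ? ?] [? ? ?] [? ? ?]] := s _ _ Uy Vx;
    split; exact/nesym.
- by rewrite hf ?g2 // => y /(s _ _ Ux)[].
- by rewrite h2 // gf // => y Uy; have [[? ? ?] [? ? ?] [? ? ?]] := s _ _ Uy Vx;
    split; exact/nesym.
by rewrite hf ?gf // => x Vx; apply: yUV; [left|right].
Qed.

(** On the images of [V] the two factors cancel, and elsewhere [h^-1] is the identity. Complements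
    of domains are obtained in this way. *)
Lemma is_cycle3_div U V f0 f1 f2 g h : V `<=` U ->
  disjoint3 U f0 f1 f2 ->
  is_cycle3 U f0 f1 f2 g -> is_cycle3 V f0 f1 f2 h ->
  is_cycle3 (U `\` V) f0 f1 f2 (g * h^-1).
Proof.
move=> VU sep [g0 g1 g2 gf] ch.
have [h0 h1 h2 hf] := is_cycle3_inv ch.
have s x y : U x -> ~ V x -> V y ->
    [/\ [/\ f0 x <> f1 y, f0 x <> f0 y & f0 x <> f2 y],
    [/\ f1 x <> f1 y, f1 x <> f0 y & f1 x <> f2 y] &
    [/\ f2 x <> f1 y, f2 x <> f0 y & f2 x <> f2 y]].
  move=> Ux nVx Vy; have nxy : x <> y by move=> xy; apply: nVx; rewrite xy.
  have [i0 i1 i2 [a b c]] := sep x y Ux (VU _ Vy).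
  have [_ _ _ [a' b' c']] := sep y x (VU _ Vy) Ux.
  by split; split=> // e; first [exact: nxy (i0 e)|exact: nxy (i1 e)
    |exact: nxy (i2 e)|exact: a' (esym e)|exact: b' (esym e)|exact: c' (esym e)].
split=> [x [Ux Vx]|x [Ux Vx]|x [Ux Vx]|y yUV]; rewrite !homeoM.
- by rewrite hf ?g0 // => y /(s _ _ Ux Vx)[].
- by rewrite hf ?g1 // => y /(s _ _ Ux Vx)[].
- by rewrite hf ?g2 // => y /(s _ _ Ux Vx)[].
have [[x [Vx [->|->|->]]]|yV] := support_cases V f0 f1 f2 y.
- by rewrite h1 // g2 //; exact: VU.
- by rewrite h0 // g0 //; exact: VU.
- by rewrite h2 // g1 //; exact: VU.
rewrite hf; last by move=> x /yV[].
by apply: gf => x Ux; have [/yV//|nVx] := pselect (V x); exact: yUV.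
Qed.

End ThreeCycle.

Section CycleIn.
Variables (X : topologicalType) (N : set (homeo X X)).
Hypothesis sN : subgroup N.
Implicit Types (g h : homeo X X) (U V : set X) (f : X -> X).

Lemma cycle3_in_rot U f0 f1 f2 :
  cycle3_in N U f0 f1 f2 -> cycle3_in N U f1 f2 f0.
Proof. by move=> [g Ng /is_cycle3_rot]; exists g. Qed.

Lemma cycle3_in_swap U f0 f1 f2 :
  cycle3_in N U f0 f1 f2 -> cycle3_in N U f1 f0 f2.
Proof.
by move=> [g Ng /is_cycle3_inv gc]; exists g^-1 => //; exact: subgroupV.
Qed.

(** A 3-cycle depends only on its cyclically ordered orbits, so its base may be changed along any
    map [p] of [V] onto [U]. This moves a base from a domain to an image and back. *)
Lemma cycle3_in_reparam U V f0 f1 f2 (p h0 h1 h2 : X -> X) :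
  (forall x, U x -> exists2 y, V y & p y = x) ->
  (forall y, V y -> [/\ U (p y), f0 (p y) = h0 y, f1 (p y) = h1 y &
    f2 (p y) = h2 y]) ->
  cycle3_in N U f0 f1 f2 -> cycle3_in N V h0 h1 h2.
Proof.
move=> Up Vp [g Ng [g0 g1 g2 gf]]; exists g => //.
split=> [y Vy|y Vy|y Vy|y yV]; try by case: (Vp _ Vy) => Upy e0 e1 e2;
  rewrite -?e0 -?e1 -?e2; auto.
by apply: gf => _ /Up[z Vz <-]; have [_ -> -> ->] := Vp _ Vz; exact: yV.
Qed.

Lemma cycle3_in_eq U f0 f1 f2 (h0 h1 h2 : X -> X) :
  (forall x, U x -> [/\ f0 x = h0 x, f1 x = h1 x & f2 x = h2 x]) ->
  cycle3_in N U f0 f1 f2 -> cycle3_in N U h0 h1 h2.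
Proof.
move=> e; apply: (@cycle3_in_reparam _ _ _ _ _ id) => x Ux; first by exists x.
by have [] := e _ Ux.
Qed.

(** Conjugation is applied backwards: a 3-cycle is first moved by an element of [N] to a position
    where it is known to lie in [N]. *)
Lemma cycle3_in_conj U f0 f1 f2 h : N h ->
  cycle3_in N U (h \o f0) (h \o f1) (h \o f2) -> cycle3_in N U f0 f1 f2.
Proof.
move=> Nh [g Ng /(is_cycle3_conj h^-1)]; rewrite invgK => gc.
exists (h^-1 * g * h); first by apply: subgroupM => //; apply: subgroupM => //;
  exact: subgroupV.
case: gc => g0 g1 g2 gf; split=> [x Ux|x Ux|x Ux|y yU].
- by have := g0 _ Ux; rewrite !homeoM /comp !homeoVK.
- by have := g1 _ Ux; rewrite !homeoM /comp !homeoVK.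
- by have := g2 _ Ux; rewrite !homeoM /comp !homeoVK.
by apply: gf => x Ux; rewrite /comp !homeoVK; exact: yU.
Qed.

Lemma cycle3_in_comm U V e f1 f2 (h1 h2 : X -> X) :
  cycle3_in N U e f1 f2 -> cycle3_in N V e h1 h2 ->
  (forall x y, U x -> V y -> [/\ e x = e y -> x = y, e x <> h1 y, e x <> h2 y,
    [/\ f1 x <> e y, f1 x <> h1 y & f1 x <> h2 y] &
    [/\ f2 x <> e y, f2 x <> h1 y & f2 x <> h2 y]]) ->
  cycle3_in N (U `&` V) e f1 h1.
Proof.
move=> [g Ng gc] [h Nh hc] sep; exists (g * h * g^-1 * h^-1).
  exact: subgroup_comm.
exact: is_cycle3_comm gc hc sep.
Qed.

Lemma cycle3_in_setU U V f0 f1 f2 : U `&` V = set0 ->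
  disjoint3 (U `|` V) f0 f1 f2 ->
  cycle3_in N U f0 f1 f2 -> cycle3_in N V f0 f1 f2 ->
  cycle3_in N (U `|` V) f0 f1 f2.
Proof.
move=> UV sep [g Ng gc] [h Nh hc]; exists (g * h); first exact: subgroupM.
exact: is_cycle3_mul.
Qed.

Lemma cycle3_in_setD U V f0 f1 f2 : V `<=` U ->
  disjoint3 U f0 f1 f2 ->
  cycle3_in N U f0 f1 f2 -> cycle3_in N V f0 f1 f2 ->
  cycle3_in N (U `\` V) f0 f1 f2.
Proof.
move=> UV sep [g Ng gc] [h Nh hc]; exists (g * h^-1).
  by apply: subgroupM => //; exact: subgroupV.
exact: is_cycle3_div.
Qed.

End CycleIn.

(** * Germs and partial homeomorphisms *)

(* [P f x] says that the germ of f at x belongs to a fixed pseudogroup of partial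
   homeomorphisms; f is total, its values away from x are irrelevant. *)
Record germ_axioms (X : topologicalType) (P : (X -> X) -> X -> Prop) : Prop := {
  germ_id : forall x, P id x;
  germ_comp : forall f g x, P f x -> P g (f x) -> P (g \o f) x;
  germ_eq_near : forall f g x, P f x -> nbhs x [set y | f y = g y] -> P g x;
  germ_continuous : forall f x, P f x -> {for x, continuous f};
  germ_open_map : forall f x N, P f x -> nbhs x N -> nbhs (f x) (f @` N);
  germ_inj_near : forall f x, P f x -> exists U, [/\ open U, U x,
    (forall y, U y -> P f y) &
    (forall y z, U y -> U z -> f y = f z -> y = z)];
  germ_inv : forall U f g, open U -> (forall x, U x -> P f x) ->
    (forall x, U x -> g (f x) = x) -> forall x, U x -> P g (f x) }.

Definition clopen_basis (X : topologicalType) : Prop :=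
  forall (x : X) N, nbhs x N -> exists C, [/\ clopen C, C x & C `<=` N].

(** Compactness as an induction on finite unions. Its near-covering form is applied to the filter on
    [set X] generated by the cones above the sets with property [R]; stability under unions makes
    these cones a filter base. *)
Lemma compact_set_ind (X : topologicalType) (U : set X) (R : set X -> Prop) :
  compact U -> R set0 -> (forall A B, R A -> R B -> R (A `|` B)) ->
  (forall x, U x -> exists V, [/\ open V, V x & R V]) ->
  exists2 W, U `<=` W & R W.
Proof.
move=> cU R0 RU loc.
pose F := filter_from R (fun W => [set B | W `<=` B]).
have FF : Filter F.
  apply: filter_from_filter; first by exists set0.
  move=> A B RA RB; exists (A `|` B); first exact: RU.
  by move=> C ABC; split=> x ?; apply: ABC; [left|right].
have /compact_near_coveringP/(_ _ F (fun B x => B x) FF) := cU.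
case=> [x /loc[V [oV Vx RV]]|W RW WU]; last by exists W => //; exact: WU.
exists (V, [set B | V `<=` B]); first by split; [exact: open_nbhs_nbhs|exists V].
by move=> [y B] /= [Vy]; apply.
Qed.

Section Iso.
Variables (X : topologicalType) (P : (X -> X) -> X -> Prop).
Hypothesis germP : germ_axioms P.
Hypotheses (cX : compact [set: X]) (hX : hausdorff_space X).
Hypothesis basisX : clopen_basis X.
Implicit Types (U V W : set X) (f : X -> X).

(** Injectivity on [U] is required separately, since germs give it only near each point. *)
Definition iso U f : Prop :=
  [/\ clopen U, forall x y, U x -> U y -> f x = f y -> x = y &
      forall x, U x -> P f x].

Lemma clopen_compact U : clopen U -> compact U.
Proof. by move=> [_ cU]; exact: subclosed_compact cU cX _. Qed.

Lemma clopen_nbhs U x : clopen U -> U x -> nbhs x U.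
Proof. by move=> [oU _] Ux; exact: open_nbhs_nbhs. Qed.

Lemma clopenD U V : clopen U -> clopen V -> clopen (U `\` V).
Proof. by move=> cU cV; rewrite setDE; apply: clopenI; last exact: clopenC. Qed.

Lemma clopen_ind U (R : set X -> Prop) : clopen U -> R set0 ->
  (forall A B, R A -> R B -> R (A `|` B)) -> (forall A, R A -> A `<=` U) ->
  (forall x, U x -> exists V, [/\ open V, V x & R V]) -> R U.
Proof.
move=> cU R0 RU Rsub loc.
have [W UW RW] := compact_set_ind (clopen_compact cU) R0 RU loc.
by rewrite (_ : U = W) //; apply/seteqP; split=> //; exact: Rsub.
Qed.

Lemma iso_id U : clopen U -> iso U id.
Proof. by move=> cU; split=> // x _; exact: germ_id. Qed.

Lemma isoS U V f : iso U f -> clopen V -> V `<=` U -> iso V f.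
Proof. by move=> [cU fi Pf] cV VU; split=> // [x y /VU ? /VU|x /VU]; auto. Qed.

Lemma iso_comp U V f g : iso U f -> iso V g -> (forall x, U x -> V (f x)) ->
  iso U (g \o f).
Proof.
move=> [cU fi Pf] [cV gi Pg] UV; split=> // [x y Ux Uy /gi|x Ux].
  by move=> H; apply: fi => //; apply: H; exact: UV.
by apply: germ_comp => //; [exact: Pf|apply/Pg/UV].
Qed.

Lemma iso_eq U f g : iso U f -> (forall x, U x -> f x = g x) -> iso U g.
Proof.
move=> [cU fi Pf] fg; split=> // [x y Ux Uy|x Ux].
  by rewrite -!fg //; exact: fi.
apply: (germ_eq_near germP (Pf _ Ux)).
by apply: filterS (clopen_nbhs cU Ux) => y; exact: fg.
Qed.

Lemma iso_image_clopen U f : iso U f -> clopen (f @` U).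
Proof.
move=> [cU fi Pf]; split.
  rewrite openE => _ [x Ux <-].
  exact: germ_open_map (Pf _ Ux) (clopen_nbhs cU Ux).
apply: compact_closed => //; apply: continuous_compact; last exact: clopen_compact.
apply: continuous_in_subspaceT => x; rewrite inE => Ux.
exact: germ_continuous (Pf _ Ux).
Qed.

Lemma iso_preimage_clopen U V f : iso U f -> clopen V ->
  clopen (U `&` f @^-1` V).
Proof.
have aux W : iso U f -> open W -> open (U `&` f @^-1` W).
  move=> [cU fi Pf] oW; rewrite openE => x [Ux Wfx].
  apply: filterI; first exact: clopen_nbhs.
  by apply: (germ_continuous germP (Pf _ Ux)); exact: open_nbhs_nbhs.
move=> Uf [oV cV]; have [[oU cU] _ _] := Uf; split; first exact: aux.
rewrite (_ : _ `&` _ = U `&` ~` (U `&` f @^-1` ~` V)).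
  by apply: closedI => //; apply: open_closedC; apply: aux => //; exact: closed_openC.
apply/seteqP; split=> x [Ux]; first by move=> Vx; split=> // -[_]; apply.
by move=> nV; split=> //; apply: contrapT => nVx; apply: nV.
Qed.

Lemma iso_inverse U f : iso U f ->
  exists2 g, iso (f @` U) g & forall x, U x -> g (f x) = x.
Proof.
move=> Uf; have [cU fi Pf] := Uf.
have /choice[g gP] y : exists x, (exists2 z, U z & f z = y) -> U x /\ f x = y.
  by have [[z Uz <-]|nz] := pselect (exists2 z, U z & f z = y); [exists z|exists y].
have gf x : U x -> g (f x) = x.
  by move=> Ux; have [//|Ug /fi] := gP (f x); [exists x|exact].
exists g => //; split; first exact: iso_image_clopen.
  by move=> _ _ [x Ux <-] [y Uy <-]; rewrite !gf // => ->.
move=> _ [x Ux <-]; apply: (germ_inv germP _ Pf) => //; by case: cU.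
Qed.

Lemma iso_glue U V f g : iso U f -> iso V g -> U `&` V = set0 ->
  (forall x y, U x -> V y -> f x <> g y) ->
  exists h, [/\ iso (U `|` V) h, forall x, U x -> h x = f x &
    forall x, V x -> h x = g x].
Proof.
move=> Uf Vg UV0 fg.
have nUV x : V x -> ~ U x by move=> Vx Ux; rewrite -[False]/(set0 x) -UV0.
pose h x := if pselect (U x) then f x else g x.
have hU x : U x -> h x = f x by rewrite /h; case: pselect.
have hV x : V x -> h x = g x by rewrite /h; case: pselect => // Ux /nUV.
have Uh := iso_eq Uf (fun x Ux => esym (hU x Ux)).
have Vh := iso_eq Vg (fun x Ux => esym (hV x Ux)).
exists h; split=> //; have [cU hi Ph] := Uh; have [cV hi' Ph'] := Vh; split.
- exact: clopenU.
- move=> x y [Ux|Vx] [Uy|Vy]; [exact: hi| | |exact: hi'].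
    by rewrite hU // hV // => /fg; case.
  by rewrite hV // hU // => /esym/fg; case.
- by move=> x [/Ph|/Ph'].
Qed.

Definition triple U f0 f1 f2 : Prop :=
  [/\ iso U f0, iso U f1, iso U f2 & disjoint3 U f0 f1 f2].

Lemma homeo_of_germ (f g : X -> X) : cancel f g -> cancel g f ->
  (forall x, P f x) -> exists h : homeo X X, homeo_fun h = f.
Proof.
move=> fK gK Pf.
have Pg x : P g x.
  rewrite -[x]gK.
  exact: (germ_inv germP openT (fun y _ => Pf y) (fun y _ => fK y)).
have cf : continuous f by move=> x; exact: (germ_continuous germP (Pf x)).
have cg : continuous g by move=> x; exact: (germ_continuous germP (Pg x)).
by exists (Homeo fK gK cf cg).
Qed.

Lemma homeo_inv_germ (h : homeo X X) : (forall x, P h x) -> forall x, P (h^-1)%g x.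
Proof.
move=> Ph x; rewrite -[x](homeoKV h).
exact: (germ_inv germP openT (fun y _ => Ph y) (fun y _ => homeoVK h y)).
Qed.

Lemma triple_rot U f0 f1 f2 : triple U f0 f1 f2 -> triple U f1 f2 f0.
Proof.
move=> [i0 i1 i2 s]; split=> // x y Ux Uy.
have [a b c [d e f]] := s _ _ Ux Uy; have [_ _ _ [d' e' f']] := s _ _ Uy Ux.
by split=> //; split=> //; exact/nesym.
Qed.

Lemma triple_swap U f0 f1 f2 : triple U f0 f1 f2 -> triple U f1 f0 f2.
Proof.
move=> [i0 i1 i2 s]; split=> // x y Ux Uy.
have [a b c [d e f]] := s _ _ Ux Uy; have [_ _ _ [d' e' f']] := s _ _ Uy Ux.
by split=> //; split=> //; exact/nesym.
Qed.

(** The map is defined by cases on the three images, which are clopen. On each it is one of the maps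
    composed with the inverse of another, and it is the identity on the clopen complement, so all
    its germs lie in the pseudogroup. *)
Let cycle_fun U f0 f1 f2 : triple U f0 f1 f2 -> exists c : X -> X,
  [/\ forall x, U x -> c (f0 x) = f1 x, forall x, U x -> c (f1 x) = f2 x,
      forall x, U x -> c (f2 x) = f0 x,
      forall y, (forall x, U x -> [/\ y <> f0 x, y <> f1 x & y <> f2 x]) ->
        c y = y & forall x, P c x].
Proof.
move=> [i0 i1 i2 s].
have [g0 Ig0 g0K] := iso_inverse i0; have [g1 Ig1 g1K] := iso_inverse i1.
have [g2 Ig2 g2K] := iso_inverse i2.
have d x y : U x -> U y -> [/\ f0 x <> f1 y, f0 x <> f2 y & f1 x <> f2 y].
  by move=> Ux Uy; case: (s x y Ux Uy).
pose c y := if pselect ((f0 @` U) y) then f1 (g0 y) else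
  if pselect ((f1 @` U) y) then f2 (g1 y) else
  if pselect ((f2 @` U) y) then f0 (g2 y) else y.
have c0 x : U x -> c (f0 x) = f1 x.
  move=> Ux; rewrite /c; case: pselect => [?|[]]; last by exists x.
  by rewrite g0K.
have c1 x : U x -> c (f1 x) = f2 x.
  move=> Ux; rewrite /c; case: pselect => [[y Uy]|?].
    by have [] := d _ _ Uy Ux.
  case: pselect => [?|[]]; last by exists x.
  by rewrite g1K.
have c2 x : U x -> c (f2 x) = f0 x.
  move=> Ux; rewrite /c; case: pselect => [[y Uy]|?].
    by have [] := d _ _ Uy Ux.
  case: pselect => [[y Uy]|?].
    by have [] := d _ _ Uy Ux.
  case: pselect => [?|[]]; last by exists x.
  by rewrite g2K.
have cf y : (forall x, U x -> [/\ y <> f0 x, y <> f1 x & y <> f2 x]) -> c y = y.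
  move=> yU; rewrite /c; case: pselect => [[x /yU[? ? ?] /esym//]|?].
  case: pselect => [[x /yU[? ? ?] /esym//]|?].
  by case: pselect => [[x /yU[? ? ?] /esym//]|?].
exists c; split=> // x.
have aux (f g h : X -> X) : iso U f -> iso U h -> iso (f @` U) g ->
    (forall x, U x -> g (f x) = x) -> (forall x, U x -> c (f x) = h x) ->
    (f @` U) x -> P c x.
  move=> If Ih Ig gK ch fUx.
  have /(iso_eq (g := c))[] : iso (f @` U) (h \o g).
  - by apply: iso_comp Ig Ih _ => _ [z Uz <-]; rewrite gK.
  - by move=> _ [z Uz <-] /=; rewrite gK // ch.
  by move=> _ _; exact.
have [|n0] := pselect ((f0 @` U) x); first exact: aux g0K c0.
have [|n1] := pselect ((f1 @` U) x); first exact: aux g1K c1.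
have [|n2] := pselect ((f2 @` U) x); first exact: aux g2K c2.
have cl : clopen (~` (f0 @` U `|` f1 @` U `|` f2 @` U)).
  apply: (clopenC set0); apply: clopenU; last exact: iso_image_clopen.
  by apply: clopenU; exact: iso_image_clopen.
have [] : iso (~` (f0 @` U `|` f1 @` U `|` f2 @` U)) c; last first.
  by move=> _ _; apply => -[[]|].
apply: (iso_eq (iso_id cl)) => y ny; rewrite cf // => z Uz.
by split=> yE; apply: ny; rewrite yE; [left; left|left; right|right]; exists z.
Qed.

Lemma cycle3_exists U f0 f1 f2 : triple U f0 f1 f2 ->
  exists2 g : homeo X X, is_cycle3 U f0 f1 f2 g & forall x, P g x.
Proof.
move=> t; have [c [c0 c1 c2 cf Pc]] := cycle_fun t.
(* Exchanging [f0] and [f1] reverses the cycle and so provides the inverse. *)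
have [d [d1 d0 d2 df Pd]] := cycle_fun (triple_swap t).
have aux (u v : X -> X) :
    [/\ forall x, U x -> v (u (f0 x)) = f0 x, forall x, U x -> v (u (f1 x)) = f1 x,
      forall x, U x -> v (u (f2 x)) = f2 x &
      forall y, (forall x, U x -> [/\ y <> f0 x, y <> f1 x & y <> f2 x]) ->
        v (u y) = y] -> cancel u v.
  move=> [u0 u1 u2 uf] y; have [[x [Ux [->|->|->]]]|yU] := support_cases U f0 f1 f2 y; auto.
have cK : cancel c d.
  apply: aux; split=> [x Ux|x Ux|x Ux|y yU].
  - by rewrite c0 // d1.
  - by rewrite c1 // d2.
  - by rewrite c2 // d0.
  - by rewrite cf // df // => x /yU[].
have dK : cancel d c.
  apply: aux; split=> [x Ux|x Ux|x Ux|y yU].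
  - by rewrite d0 // c2.
  - by rewrite d1 // c0.
  - by rewrite d2 // c1.
  - by rewrite df ?cf // => x /yU[].
have [h hc] := homeo_of_germ cK dK Pc.
by exists h; rewrite /is_cycle3 hc.
Qed.

Lemma tripleS U V f0 f1 f2 : triple U f0 f1 f2 -> clopen V -> V `<=` U ->
  triple V f0 f1 f2.
Proof.
move=> [i0 i1 i2 s] cV VU; split; try exact: isoS cV VU.
by move=> x y /VU Ux /VU Uy; exact: s.
Qed.

Lemma triple_homeo U f0 f1 f2 (g : homeo X X) : (forall x, P g x) ->
  triple U f0 f1 f2 -> triple U (g \o f0) (g \o f1) (g \o f2).
Proof.
move=> Pg [i0 i1 i2 s].
have Ig : iso setT g.
  by split=> //; [exact: clopenT|move=> x y _ _ /homeo_inj].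
split; try exact: iso_comp Ig _.
move=> x y Ux Uy; have [a b c [d e f]] := s _ _ Ux Uy.
by split; try split; move=> /= /homeo_inj.
Qed.

Definition full (N : set (homeo X X)) W : Prop := forall U f0 f1 f2,
  triple U f0 f1 f2 ->
  (forall x, U x -> [/\ W (f0 x), W (f1 x) & W (f2 x)]) ->
  cycle3_in N U f0 f1 f2.

Lemma full_sub N V W : V `<=` W -> full N W -> full N V.
Proof.
by move=> VW fW U f0 f1 f2 t UV; apply: fW => // x /UV[/VW ? /VW ? /VW ?].
Qed.

(** * Consequences of minimality and pure infiniteness *)

Section Flexible.
Hypothesis minimalP : forall x V, open V -> V !=set0 -> exists f, P f x /\ V (f x).
Hypothesis infiniteP : forall Z, clopen Z -> exists f g,
  [/\ iso Z f, iso Z g, forall x, Z x -> Z (f x), forall x, Z x -> Z (g x) &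
      forall x y, Z x -> Z y -> f x <> g y].

(** Minimality embeds a neighbourhood of each point into [V]. To glue embeddings over two sets, they
    are first composed with the self-embeddings [u] and [v] of [V], whose disjoint images separate
    the values. *)
Lemma iso_embedding U V : clopen U -> clopen V -> V !=set0 ->
  exists2 f, iso U f & forall x, U x -> V (f x).
Proof.
move=> cU cV V0; have [u [v [Iu Iv uV vV uv]]] := infiniteP cV.
pose R A := A `<=` U /\ exists2 f, iso A f & forall x, A x -> V (f x).
suff [] : R U by [].
apply: (clopen_ind cU (R := R)).
- by split=> //; exists id => //; apply: iso_id; exact: clopen0.
- move=> A B [AU [f If fV]] [BU [g Ig gV]]; split; first by move=> x [/AU|/BU].
  have [cA _ _] := If; have [cB _ _] := Ig.
  have Ig' : iso (B `\` A) g by apply: isoS Ig (clopenD cB cA) _ => x [].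
  have [h [Ih hA hB]] : exists h, [/\ iso (A `|` B `\` A) h,
      forall x, A x -> h x = u (f x) & forall x, (B `\` A) x -> h x = v (g x)].
    apply: iso_glue.
    + exact: iso_comp If Iu fV.
    + by apply: iso_comp Ig' Iv _ => x [/gV].
    + by apply/seteqP; split=> x // [Ax []].
    + by move=> x y /fV ? [/gV ? _]; exact: uv.
  have AB : A `|` B = A `|` B `\` A.
    apply/seteqP; split=> x; last by case=> [|[]]; [left|right].
    by case=> [|Bx]; [left|have [|] := pselect (A x); [left|right]].
  rewrite AB; exists h => // x [Ax|Bx]; first by rewrite hA //; exact/uV/fV.
  by rewrite hB //; apply/vV/gV; case: Bx.
- by move=> A [].
- move=> x Ux; have [f [Pf Vfx]] := minimalP x (proj1 cV) V0.
  have [O [oO Ox PO Oi]] := germ_inj_near germP Pf.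
  have nC : nbhs x (U `&` (O `&` f @^-1` V)).
    apply: filterI; first exact: clopen_nbhs.
    apply: filterI; first exact: open_nbhs_nbhs.
    by apply: (germ_continuous germP Pf); exact: clopen_nbhs.
  have [C [cC Cx CO]] := basisX nC.
  exists C; split=> //; first by case: cC.
  split; first by move=> y /CO[].
  exists f; last by move=> y /CO[_ []].
  by split=> // [y z /CO[_ [Oy _]] /CO[_ [Oz _]]|y /CO[_ [/PO]]] //; exact: Oi.
Qed.

Lemma iso_embedding2 U V : clopen U -> clopen V -> V !=set0 ->
  exists f g, [/\ iso U f, iso U g, forall x, U x -> V (f x),
    forall x, U x -> V (g x) & forall x y, U x -> U y -> f x <> g y].
Proof.
move=> cU cV V0; have [f If fV] := iso_embedding cU cV V0.
have [u [v [Iu Iv uV vV uv]]] := infiniteP cV.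
exists (u \o f), (v \o f); split.
- exact: iso_comp If Iu fV.
- exact: iso_comp If Iv fV.
- by move=> x /fV/uV.
- by move=> x /fV/vV.
- by move=> x y /fV ? /fV ?; exact: uv.
Qed.

(** The copies are [u], [v u], [v v u] and so on: applying [v] to the copies found so far leaves
    room for [u]. *)
Lemma iso_copies n Z : clopen Z -> exists e : nat -> X -> X,
  [/\ forall i, (i < n)%N -> iso Z (e i),
      forall i x, (i < n)%N -> Z x -> Z (e i x) &
      forall i j x y, (i < n)%N -> (j < n)%N -> Z x -> Z y ->
        e i x = e j y -> i = j /\ x = y].
Proof.
move=> cZ; have [u [v [Iu Iv uZ vZ uv]]] := infiniteP cZ.
have [_ ui _] := Iu; have [_ vi _] := Iv.
elim: n => [|n [e [Ie eZ ei]]]; first by exists (fun=> id).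
exists (fun i => if i is k.+1 then v \o e k else u); split.
- case=> [|i] //; rewrite ltnS => ltin.
  by apply: iso_comp (Ie _ ltin) Iv _ => x; exact: eZ.
- case=> [|i] x; rewrite ?ltnS => ltin Zx; first exact: uZ.
  by apply: vZ; exact: eZ.
- case=> [|i] [|j] x y; rewrite ?ltnS => ltin ltjn Zx Zy /=.
  + by move=> /ui; split=> //; auto.
  + by move=> /uv; case=> //; exact: eZ.
  + by move=> /esym/uv; case=> //; exact: eZ.
  + move=> /vi vE; have /ei[//|//|//|//|-> ->] // : e i x = e j y.
    by apply: vE; exact: eZ.
Qed.

(** Self-embeddings make a nonempty clopen set infinite: [(size s).+1] copies of one point cannot
    all lie in [s]. *)
Lemma clopen_avoid W (s : seq X) : clopen W -> W !=set0 ->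
  exists2 y, W y & y \notin s.
Proof.
move=> cW [w Ww]; have [e [_ eW ei]] := iso_copies (size s).+1 cW.
apply: contrapT => nW.
pose t := [seq e i w | i <- iota 0 (size s).+1].
have ut : uniq t.
  rewrite map_inj_in_uniq ?iota_uniq // => i j.
  by rewrite !mem_iota /= !add0n => ? ? /ei[].
have ts : {subset t <= s}.
  move=> x /mapP[i]; rewrite mem_iota /= add0n => lti ->.
  by apply: contrapT => /negP ns; apply: nW; exists (e i w) => //; exact: eW.
by have := uniq_leq_size ut ts; rewrite size_map size_iota ltnn.
Qed.

(** * Moving clopen sets by 3-cycles and enlarging supports *)

Section Vigorous.
Variable N : set (homeo X X).
Hypothesis sN : subgroup N.
Implicit Types g h : homeo X X.

(** The 3-cycle through [Z] and two disjoint copies of [Z] inside [C] sends [Z] into [C]. *)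
Let vigorous_disjoint W Z C : full N W -> clopen Z -> Z `<=` W ->
  clopen C -> C `<=` W -> C !=set0 -> C `&` Z = set0 ->
  exists g, [/\ N g, forall x, Z x -> C (g x) & forall x, ~ W x -> g x = x].
Proof.
move=> fW cZ ZW cC CW C0 CZ.
have [f [h [If Ih fC hC fh]]] := iso_embedding2 cZ cC C0.
have nZ x y : Z x -> C y -> x <> y.
  by move=> Zx Cy xy; rewrite -[False]/(set0 y) -CZ -xy; split=> //; rewrite xy.
have [] := fW Z id f h.
- split=> //; first exact: iso_id.
  move=> x y Zx Zy; have [_ fi _] := If; have [_ hi _] := Ih; split=> //.
  + exact: fi.
  + exact: hi.
  + by split; [apply/nZ/fC|apply/nZ/hC|exact: fh].
- by move=> x Zx; split; [exact: ZW|apply/CW/fC|apply/CW/hC].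
move=> g Ng [g0 g1 g2 gf]; exists g; split=> // [x Zx|x nWx].
  by rewrite g0 //; exact: fC.
apply: gf => y Zy; split=> xE; apply: nWx; rewrite xE; first exact: ZW.
  exact/CW/fC.
exact/CW/hC.
Qed.

(** If [C] is not inside [Z], the part of [C] outside [Z] is a target disjoint from [Z]. Otherwise
    the move is made in two steps, from [Z] into the complement of [Z] in [W] and from there into
    [C]. *)
Lemma vigorous W Z C : full N W -> clopen W -> clopen Z -> Z `<=` W ->
  W `\` Z !=set0 -> clopen C -> C `<=` W -> C !=set0 ->
  exists g, [/\ N g, forall x, Z x -> C (g x) & forall x, ~ W x -> g x = x].
Proof.
move=> fW cW cZ ZW WZ cC CW C0.
have [CZ0|CZ] := pselect (C `\` Z !=set0).
  have [|||||||g [Ng gZ gf]] := @vigorous_disjoint W Z (C `\` Z) => //.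
  - exact: clopenD.
  - by move=> x [/CW].
  - by apply/seteqP; split=> x // [[]].
  by exists g; split=> // x /gZ[].
have {}CZ : C `<=` Z.
  by move=> x Cx; apply: contrapT => nZx; apply: CZ; exists x.
have [|||||||g [Ng gZ gf]] := @vigorous_disjoint W Z (W `\` Z) => //.
- exact: clopenD.
- by apply/seteqP; split=> x // [[]].
have [|||||||h [Nh hZ hf]] := @vigorous_disjoint W (W `\` Z) C => //.
- exact: clopenD.
- by apply/seteqP; split=> x // [/CZ ? []].
exists (h * g); split; first exact: subgroupM.
  by move=> x /gZ/hZ.
by move=> x nW; rewrite homeoM gf // hf.
Qed.

(** The hypothesis speaks of all clopen [B] inside [V], so that overlapping bases can be cut into
    disjoint ones; cycles over disjoint bases multiply to the cycle over the union. *)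
Lemma cycle3_in_local U f0 f1 f2 : triple U f0 f1 f2 ->
  (forall x, U x -> exists V, [/\ open V, V x &
    forall B, clopen B -> B `<=` V -> B `<=` U -> cycle3_in N B f0 f1 f2]) ->
  cycle3_in N U f0 f1 f2.
Proof.
move=> t loc; have [[cU _ _] _ _ sep] := t.
pose R A := [/\ clopen A, A `<=` U &
  forall B, clopen B -> B `<=` A -> cycle3_in N B f0 f1 f2].
suff [_ _ RU] : R U by exact: RU.
apply: (clopen_ind cU (R := R)).
- split=> //; first exact: clopen0.
  move=> B _ B0; exists 1; first exact: subgroup1.
  by split=> // x /B0.
- move=> A B [cA AU rA] [cB BU rB]; split; first exact: clopenU.
    by move=> x [/AU|/BU].
  move=> C cC CAB.
  have -> : C = (C `&` A) `|` (C `\` A).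
    apply/seteqP; split=> x; last by case=> [[]|[]].
    by move=> Cx; have [|] := pselect (A x); [left|right].
  apply: cycle3_in_setU => //.
  + by apply/seteqP; split=> x // [[_ ?] []].
  + move=> x y xC yC; apply: sep.
      by case: xC => [[_ /AU]|[/CAB[/AU|/BU]]].
    by case: yC => [[_ /AU]|[/CAB[/AU|/BU]]].
  + by apply: rA; [exact: clopenI|move=> x []].
  + by apply: rB; [exact: clopenD|move=> x [/CAB[]]].
- by move=> A [].
- move=> x Ux; have [V [oV Vx VB]] := loc _ Ux.
  have [|C [cC Cx CV]] := basisX (x := x) (N := U `&` V).
    by apply: filterI; [exact: clopen_nbhs|exact: open_nbhs_nbhs].
  exists C; split=> //; first by case: cC.
  split=> //; first by move=> y /CV[].
  by move=> B cB BC; apply: VB => // y /BC/CV[].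
Qed.

Hypothesis germN : forall g, N g -> forall x, P g x.

Lemma full_translate W (h : homeo X X) : N h -> full N W -> full N (h @` W).
Proof.
move=> Nh fW U f0 f1 f2 t UW; have Nh' := subgroupV sN Nh.
apply: (cycle3_in_conj sN Nh'); apply: fW.
  by apply: triple_homeo => //; exact: germN.
move=> x /UW; rewrite /comp => -[[y0 W0 <-] [y1 W1 <-] [y2 W2 <-]].
by rewrite !homeoVK.
Qed.

(** The base is shrunk around [x] until the support [S] misses some point [y] of [W]. Then some [g]
    in [N], fixing every point outside [W], pushes the part of [S] in [W] into the overlap, and
    conjugation by [g] brings the whole cycle into [W']. *)
Lemma fullU W W' : clopen W -> clopen W' -> W `&` W' !=set0 ->
  full N W -> full N W' -> full N (W `|` W').
Proof.
move=> cW cW' WW' fW fW' U f0 f1 f2 t UW.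
apply: cycle3_in_local => // x Ux.
have W0 : W !=set0 by case: WW' => y [Wy _]; exists y.
have [y Wy] := clopen_avoid [:: f0 x; f1 x; f2 x] cW W0.
rewrite !inE !negb_or => /and3P[y0 y1 y2].
have [I0 I1 I2 _] := t.
have cy f : iso U f -> y != f x -> nbhs x [set z | f z <> y].
  move=> [_ _ Pf] yf.
  have /(_ (~` [set y])) := germ_continuous germP (Pf _ Ux); apply.
  apply: open_nbhs_nbhs; split; last by move=> /= e; rewrite e eqxx in yf.
  apply: closed_openC; apply: accessible_closed_set1.
  exact: hausdorff_accessible.
have [V [cV Vx VU]] := basisX (filterI (cy _ I0 y0) (filterI (cy _ I1 y1) (cy _ I2 y2))).
exists V; split=> //; first by case: cV.
move=> B cB BV BU; have tB := tripleS t cB BU; have [J0 J1 J2 _] := tB.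
pose S := f0 @` B `|` f1 @` B `|` f2 @` B.
have cS : clopen S by apply: clopenU; [apply: clopenU|]; exact: iso_image_clopen.
have [||||||||g [Ng gZ gf]] := @vigorous W (W `&` S) (W `&` W') => //.
- exact: clopenI.
- exists y; split=> // -[_ [[[z /BV/VU[]]|[z /BV/VU[_ []]]]|[z /BV/VU[_ []]]]] //.
- exact: clopenI.
apply: (cycle3_in_conj sN Ng); apply: fW'.
  by apply: triple_homeo => //; exact: germN.
have aux z : S z -> (W `|` W') z -> W' (g z).
  move=> Sz [Wz|Wz]; first by have [] := gZ z (conj Wz Sz).
  have [Wz'|nW] := pselect (W z); first by have [] := gZ z (conj Wz' Sz).
  by rewrite gf.
move=> z Bz; have [? ? ?] := UW z (BU _ Bz).
by split; apply: aux => //; [left; left|left; right|right]; exists z.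
Qed.

End Vigorous.
End Flexible.

Lemma triple_eq U f0 f1 f2 g0 g1 g2 : triple U f0 f1 f2 ->
  (forall x, U x -> [/\ f0 x = g0 x, f1 x = g1 x & f2 x = g2 x]) ->
  triple U g0 g1 g2.
Proof.
move=> [i0 i1 i2 s] fg; split.
- by apply: iso_eq i0 _ => x /fg[].
- by apply: iso_eq i1 _ => x /fg[].
- by apply: iso_eq i2 _ => x /fg[].
by move=> x y Ux Uy; have [<- <- <-] := fg _ Ux; have [<- <- <-] := fg _ Uy; exact: s.
Qed.
End Iso.

(** * Finite generation *)

(* Words in the partial maps b j : D j -> X together with their exact domains. *)
Inductive word (X : Type) (J : Type) (D : J -> set X) (b : J -> X -> X) :
    set X -> (X -> X) -> Prop :=
| word_nil : word D b setT id
| word_cons V w j : word D b V w -> word D b (V `&` w @^-1` D j) (b j \o w).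

Lemma fresh_index n (s : seq 'I_n) : (size s < n)%N -> exists l, l \notin s.
Proof.
move=> sn; apply: contrapT => nl; suff: (n <= size s)%N by rewrite leqNgt sn.
rewrite -[n in (n <= _)%N]size_enum_ord; apply: uniq_leq_size; first exact: enum_uniq.
by move=> i _; apply: contrapT => /negP ns; apply: nl; exists i.
Qed.

(** This is where five copies are used: a commutator drops the last leg of each factor, and these
    two legs can be placed in copies away from the three that remain. *)
Lemma extend_uniq3 (i j k : 'I_5) : uniq [:: i; j; k] ->
  exists l m, uniq [:: m; l; i; j; k].
Proof.
move=> u; have [//|l ls] := @fresh_index 5 [:: i; j; k].
have [//|m ms] := @fresh_index 5 [:: l; i; j; k].
by exists l, m; rewrite cons_uniq ms cons_uniq ls.
Qed.

(** * Encoding partial maps by 3-cycles between five copies *)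

Section Spread.
Variables (X : topologicalType) (P : (X -> X) -> X -> Prop).
Hypothesis germP : germ_axioms P.
Hypotheses (cX : compact [set: X]) (hX : hausdorff_space X).
Hypothesis basisX : clopen_basis X.
Variables (J : finType) (D : J -> set X) (b : J -> X -> X) (j0 : J).
Hypotheses (Db : forall j, iso P (D j) (b j)) (D0 : D j0 = setT) (b0 : b j0 = id).
Hypothesis expansiveP : forall U s x, open U -> U x -> (forall y, U y -> P s y) ->
  exists V w, [/\ word D b V w, open V, V x, V `<=` U & forall y, V y -> w y = s y].
Variable e : 'I_5 -> X -> X.
Hypotheses (Ie : forall i, iso P setT (e i))
  (ei : forall i j x y, e i x = e j y -> i = j /\ x = y).
Variable N : set (homeo X X).
Hypotheses (sN : subgroup N) (germN : forall g, N g -> forall x, P g x).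
Hypothesis NT : forall j i k l, uniq [:: i; k; l] ->
  cycle3_in N (D j) (e i) (e k \o b j) (e l).
Implicit Types (U V : set X) (s t f : X -> X).

Let eI i x y : e i x = e i y -> x = y. Proof. by case/ei. Qed.
Let eN i j x y : i != j -> e i x <> e j y.
Proof. by move=> ij /ei[] /eqP; rewrite (negPf ij). Qed.

Ltac distinct u :=
  let H := fresh in
  have H := u; rewrite /= !inE !negb_or -?andbA /= in H;
  repeat (case/andP: H => ? H).

Ltac uniq3 := rewrite /= !inE !negb_or -?andbA;
  repeat (apply/andP; split); first [done | by rewrite eq_sym].

Ltac separate := rewrite /comp; split; [|by first [exact: eN|apply: eN; rewrite eq_sym]..| |];
  first [exact: eI | split; first [exact: eN|apply: eN; rewrite eq_sym //] | idtac].

(** The partial map [s] is recorded by the leg from copy [i] to copy [j]. All choices of distinct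
    copies are asked for, so that commutators can use spare ones. *)
Definition spread U s : Prop := forall i j k, uniq [:: i; j; k] ->
  cycle3_in N U (e i) (e j \o s) (e k).

Lemma spread_gen j : spread (D j) (b j).
Proof. by move=> i k l; exact: NT. Qed.

Lemma spread_setT : spread setT id.
Proof. by rewrite -D0 -b0; exact: spread_gen. Qed.

Lemma spread_eq U s t : (forall x, U x -> s x = t x) -> spread U s -> spread U t.
Proof.
move=> st sp i j k u; apply: cycle3_in_eq _ (sp _ _ _ u) => x Ux.
by rewrite /comp st.
Qed.

(** Commutators forget last legs: with [s] placed there it disappears, while its domain [U] is
    kept. *)
Lemma spread_id U s : spread U s -> spread U id.
Proof.
move=> sp i j k u; have [l [m um]] := extend_uniq3 u; distinct um.
have c1 : cycle3_in N U (e j) (e i) (e l \o s).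
  apply/cycle3_in_rot/cycle3_in_rot/sp.
  by uniq3.
have c2 : cycle3_in N setT (e j) (e k) (e m).
  apply: spread_setT.
  by uniq3.
rewrite -[U]setIT; apply: cycle3_in_swap => //.
by apply: (cycle3_in_comm sN c1 c2) => x y _ _; separate.
Qed.

Lemma spreadI U V s : spread U s -> spread V id -> spread (U `&` V) s.
Proof.
move=> sU sV i j k u; have [l [m um]] := extend_uniq3 u; distinct um.
have c1 : cycle3_in N U (e i) (e j \o s) (e l) by apply: sU; uniq3.
have c2 : cycle3_in N V (e i) (e k) (e m) by apply: sV; uniq3.
by apply: (cycle3_in_comm sN c1 c2) => x y _ _; separate.
Qed.

(** With [t] inverse to [s], the cycle becomes one over the image of [s] in which the leg [e j] is
    bare and the other two contain [t]. Two commutators around [e j] replace those by [e k] and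
    [e i]. *)
Lemma spread_image U s : (forall x y, U x -> U y -> s x = s y -> x = y) ->
  spread U s -> spread (s @` U) id.
Proof.
move=> si sU i j k u; have [l [m um]] := extend_uniq3 u; distinct um.
have /choice[t tP] y : exists x, (s @` U) y -> U x /\ s x = y.
  by have [[x Ux <-]|ny] := pselect ((s @` U) y); [exists x|exists y].
have tK x : U x -> t (s x) = x.
  by move=> Ux; have [|Ut /si] := tP (s x); [exists x|exact].
have c1 : cycle3_in N U (e i) (e j \o s) (e l) by apply: sU; uniq3.
have c2 : cycle3_in N (s @` U) (e i \o t) (e j) (e l \o t).
  apply: (cycle3_in_reparam (p := t)) c1 => [x Ux|y /tP[Ut sy]].
    by exists (s x); [exists x|exact: tK].
  by rewrite /comp sy.
have c3 : cycle3_in N setT (e j) (e k) (e m) by apply: spread_setT; uniq3.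
have c4 : cycle3_in N (s @` U) (e j) (e l \o t) (e k).
  rewrite -[X in cycle3_in _ X]setIT.
  apply: (cycle3_in_comm sN (cycle3_in_rot c2) c3) => x y _ _; separate.
have c5 : cycle3_in N (s @` U) (e j) (e k) (e l \o t).
  by apply: cycle3_in_swap => //; do 2 apply: cycle3_in_rot.
have c6 : cycle3_in N setT (e j) (e i) (e m) by apply: spread_setT; uniq3.
do 2 apply: cycle3_in_rot; rewrite -[X in cycle3_in _ X]setIT.
by apply: (cycle3_in_comm sN c5 c6) => x y _ _; separate.
Qed.

(** The cycle of [t] is pulled back along [s], so that it shares the leg [e l \o s] with a cycle of
    [s]. Their commutator joins [e i] to [e j \o (t \o s)], and a commutator around [e i] then
    replaces [e l \o s] by [e k]. *)
Lemma spread_comp U V s t : (forall x y, U x -> U y -> s x = s y -> x = y) ->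
  spread U s -> spread V t -> spread (U `&` s @^-1` V) (t \o s).
Proof.
move=> si sU tV i j k u; have [l [m um]] := extend_uniq3 u; distinct um.
have c1 : cycle3_in N U (e l \o s) (e i) (e m).
  by apply: cycle3_in_swap => //; apply: sU; uniq3.
have c2 : cycle3_in N (V `&` s @` U) (e l) (e j \o t) (e k).
  by apply: (spreadI tV (spread_image si sU)); uniq3.
have c3 : cycle3_in N (U `&` s @^-1` V) (e l \o s) (e j \o (t \o s)) (e k \o s).
  apply: (cycle3_in_reparam (p := s)) c2 => [z [Vz [x Ux xz]]|x [Ux Vx]].
    by exists x => //; split=> //=; rewrite xz.
  by split=> //; split=> //; exists x.
have c4 : cycle3_in N (U `&` s @^-1` V) (e l \o s) (e i) (e j \o (t \o s)).
  rewrite -[X in cycle3_in _ X](setIidr (@subIsetl _ U (s @^-1` V))).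
  apply: (cycle3_in_comm sN c1 c3) => x y Ux [Uy _]; separate.
  by move=> /eI; exact: si.
have c5 : cycle3_in N setT (e i) (e k) (e m) by apply: spread_setT; uniq3.
rewrite -[X in cycle3_in _ X]setIT.
by apply: (cycle3_in_comm sN (cycle3_in_rot c4) c5) => x y _ _; separate.
Qed.

Lemma spreadD U V s : (forall x y, U x -> U y -> s x = s y -> x = y) ->
  V `<=` U -> spread U s -> spread V s -> spread (U `\` V) s.
Proof.
move=> si VU sU sV i j k u.
apply: cycle3_in_setD (sU _ _ _ u) (sV _ _ _ u) => // x y Ux Uy.
have := u; rewrite /= !inE negb_or andbT => /andP[/andP[ij ik] jk].
split; [exact: eI|by move=> /eI; exact: si|exact: eI|].
by split; exact: eN.
Qed.

Lemma spreadC U : spread U id -> spread (~` U) id.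
Proof. by rewrite -setTD => sU; apply: spreadD => //; exact: spread_setT. Qed.

Lemma spreadU U V s :
  (forall x y, (U `|` V) x -> (U `|` V) y -> s x = s y -> x = y) ->
  spread U s -> spread V s -> spread (U `|` V) s.
Proof.
move=> si sU sV.
have sVU : spread (V `\` U) s by exact/(spreadI sV)/spreadC/(spread_id sU).
have -> : U `|` V = U `|` V `\` U.
  apply/seteqP; split=> x; last by case=> [|[]]; [left|right].
  by case=> [|Bx]; [left|have [|] := pselect (U x); [left|right]].
move=> i j k u; apply: cycle3_in_setU (sU _ _ _ u) (sVU _ _ _ u) => //.
  by apply/seteqP; split=> x // [? []].
move=> x y Ux Uy.
have := u; rewrite /= !inE negb_or andbT => /andP[/andP[ij ik] jk].
split; [exact: eI| |exact: eI|by split; exact: eN].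
move=> /eI; apply: si; first by case: Ux => [|[]]; [left|right].
by case: Uy => [|[]]; [left|right].
Qed.

Lemma spread0 s : spread set0 s.
Proof.
move=> i j k u; exists 1; first exact: subgroup1.
by split.
Qed.

Lemma spread_word V w : word D b V w ->
  spread V w /\ forall x y, V x -> V y -> w x = w y -> x = y.
Proof.
elim=> [|{}V {}w j _ [sV wi]]; first by split=> //; exact: spread_setT.
split; first exact: spread_comp wi sV (@spread_gen j).
by have [_ bi _] := Db j; move=> x y [Vx Dx] [Vy Dy] /bi/wi; auto.
Qed.

Lemma spread_iso U s : iso P U s -> spread U s.
Proof.
move=> Is; have [cU si Ps] := Is.
pose R A := A `<=` U /\ spread A s.
suff [] : R U by [].
apply: (clopen_ind cX cU (R := R)).
- by split=> //; exact: spread0.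
- move=> A B [AU sA] [BU sB]; split; first by move=> x [/AU|/BU].
  by apply: spreadU => // x y [/AU|/BU] ? [/AU|/BU] ?; exact: si.
- by move=> A [].
move=> x Ux; have [V [w [wV oV Vx VU ws]]] := expansiveP (proj1 cU) Ux Ps.
exists V; split=> //; split=> //; apply: (spread_eq ws).
by have [] := spread_word wV.
Qed.

(* A 3-cycle of N conjugates e_j into a fresh copy e_l on the image of f1, fixing
   the images of f0 and f2 even when these lie in the same copy as that of f1. *)
Let cycle3_in_move U f0 f1 f2 s i j k l : triple P U f0 f1 f2 ->
  iso P U s -> (forall x, U x -> f1 x = e j (s x)) ->
  (forall x, U x -> exists z, f0 x = e i z) ->
  (forall x, U x -> exists z, f2 x = e k z) ->
  l \notin [:: i; j; k] ->
  triple P U f0 (e l \o s) f2 /\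
  (cycle3_in N U f0 (e l \o s) f2 -> cycle3_in N U f0 f1 f2).
Proof.
move=> t Is f1E f0E f2E ln.
have [//|m mn] := @fresh_index 5 [:: l; i; j; k].
move: ln mn; rewrite !inE !negb_or => /and3P[li lj lk] /and4P[ml mi mj mk].
have sV : spread (s @` U) id by exact/spread_iso/iso_id/(iso_image_clopen germP cX hX Is).
have [|g Ng [g0 g1 g2 gf]] := sV j l m.
  by rewrite /= !inE !negb_or eq_sym lj eq_sym mj eq_sym ml.
have fixg y : (forall x, U x -> y <> f1 x) -> (exists n z, y = e n z /\ (n != l) && (n != m)) ->
    g y = y.
  move=> yU [n [z [yE /andP[nl nm]]]]; apply: gf => _ [x Ux <-].
  rewrite yE; split; [|exact: eN|exact: eN].
  by move=> ez; apply: (yU x Ux); rewrite f1E // yE.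
have [_ _ _ sep] := t.
have gE x : U x -> [/\ (g \o f0) x = f0 x, (g \o f1) x = (e l \o s) x &
    (g \o f2) x = f2 x].
  move=> Ux; rewrite /comp; split.
  - apply: fixg => [y Uy|]; first by have [_ _ _ []] := sep _ _ Ux Uy.
    by have [z ->] := f0E x Ux; exists i, z; rewrite eq_sym li eq_sym mi.
  - by rewrite f1E // g0 //; exists x.
  - apply: fixg => [y Uy|]; first by have [_ _ _ [_ _ /nesym]] := sep _ _ Uy Ux.
    by have [z ->] := f2E x Ux; exists k, z; rewrite eq_sym lk eq_sym mk.
split; first exact: (triple_eq germP (triple_homeo germP (germN Ng) t) gE).
move=> c; apply: (cycle3_in_conj sN Ng).
by apply: cycle3_in_eq c => x /gE[-> -> ->].
Qed.

(** Taking the image of [s0] as base makes the first leg bare; the cycle is then a commutator of the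
    spread cycles of [s1 \o t] and [s2 \o t], with [t] inverse to [s0]. *)
Let cycle3_in_distinct U s0 s1 s2 i j k : uniq [:: i; j; k] ->
  iso P U s0 -> iso P U s1 -> iso P U s2 ->
  cycle3_in N U (e i \o s0) (e j \o s1) (e k \o s2).
Proof.
move=> u I0 I1 I2; have [l [m um]] := extend_uniq3 u; distinct um.
have [t It tK] := iso_inverse germP cX hX I0.
have It1 : iso P (s0 @` U) (s1 \o t).
  by apply: (iso_comp germP It I1) => _ [x Ux <-]; rewrite tK.
have It2 : iso P (s0 @` U) (s2 \o t).
  by apply: (iso_comp germP It I2) => _ [x Ux <-]; rewrite tK.
have c1 : cycle3_in N (s0 @` U) (e i) (e j \o (s1 \o t)) (e l).
  by apply: (spread_iso It1); uniq3.
have c2 : cycle3_in N (s0 @` U) (e i) (e k \o (s2 \o t)) (e m).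
  by apply: (spread_iso It2); uniq3.
have := cycle3_in_comm sN c1 c2; rewrite setIid => c3.
apply: (cycle3_in_reparam (p := s0)) (c3 _) => [y [x Ux <-]|x Ux|].
- by exists x.
- by rewrite /comp !tK //; split=> //; exists x.
- by move=> x y _ _; separate.
Qed.

(** Near a point each of the three maps takes values in a single copy. The second and third legs are
    conjugated into fresh copies [l] and [m], so that coinciding copies become distinct. *)
Lemma full_spread : full P N (\bigcup_i (e i @` setT)).
Proof.
move=> U f0 f1 f2 t UW; apply: (cycle3_in_local cX basisX sN t) => x Ux.
have /choice[r rP] i : exists g, iso P (e i @` setT) g /\ forall x, g (e i x) = x.
  by have [g ? gK] := iso_inverse germP cX hX (Ie i); exists g; split=> // z; exact: gK.
have [[i _ [x0 _ x0E]] [j _ [x1 _ x1E]] [k _ [x2 _ x2E]]] := UW _ Ux.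
have [I0 I1 I2 _] := t; have [cU _ _] := I0.
have cE n : clopen (e n @` setT) := iso_image_clopen germP cX hX (Ie n).
pose V := (U `&` f0 @^-1` (e i @` setT)) `&` ((U `&` f1 @^-1` (e j @` setT)) `&`
  (U `&` f2 @^-1` (e k @` setT))).
have cV : clopen V by do 2 (apply: clopenI; first exact: (iso_preimage_clopen germP));
  exact: (iso_preimage_clopen germP).
exists V; split; first by case: cV.
  by split; [split=> //; exists x0|split; split=> //; [exists x1|exists x2]].
move=> B cB BV BU; have tB := tripleS t cB BU; have [J0 J1 J2 _] := tB.
have rI n f : iso P B f -> (forall y, B y -> (e n @` setT) (f y)) ->
    iso P B (r n \o f) /\ forall y, B y -> f y = e n ((r n \o f) y).
  move=> If fe; have [Ir rK] := rP n; split; first exact: (iso_comp germP If Ir fe).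
  by move=> y /fe[z _ zE]; rewrite /= -zE rK.
have [K0 E0] := rI i f0 J0 (fun y By => proj2 (proj1 (BV y By))).
have [K1 E1] := rI j f1 J1 (fun y By => proj2 (proj1 (proj2 (BV y By)))).
have [K2 E2] := rI k f2 J2 (fun y By => proj2 (proj2 (proj2 (BV y By)))).
have [//|l ln] := @fresh_index 5 [:: i; j; k].
have [||t1 mv1] := cycle3_in_move tB K1 E1 _ _ ln.
- by move=> y /E0 yE; exists (r i (f0 y)).
- by move=> y /E2 yE; exists (r k (f2 y)).
apply: mv1.
have [//|m mn] := @fresh_index 5 [:: l; k; i].
apply/cycle3_in_rot/cycle3_in_rot.
have [||t2 mv2] := cycle3_in_move (triple_rot t1) K2 E2 _ _ mn.
- by move=> y _; exists (r j (f1 y)).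
- by move=> y /E0 yE; exists (r i (f0 y)).
apply: mv2; apply/cycle3_in_rot.
apply: (@cycle3_in_eq _ _ _ (e i \o (r i \o f0)) (e l \o (r j \o f1)) (e m \o (r k \o f2))).
  by move=> y By; split=> //; rewrite [RHS]E0.
apply: cycle3_in_distinct => //.
move: ln mn; rewrite /= !inE !negb_or => /and3P[li lj lk] /and3P[ml mk mi].
by rewrite eq_sym li eq_sym mi eq_sym ml.
Qed.
End Spread.

(** Adding two powers of 4 in base 4 produces no carry, so the digits of the sum determine the
    exponents; the induction compares last digits. *)
Lemma sidon_exp4 i j l m :
  (4 ^ j + 4 ^ l = 4 ^ i + 4 ^ m)%N -> i != j -> l = i.
Proof.
elim: i j l m => [|i IH] j l m.
  by case: j l m => [|j] [|l] [|m] //; rewrite ?expnS ?expn0; lia.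
case: j l m => [|j] [|l] [|m]; rewrite ?expnS ?expn0 ?eqSS => E ij; try lia.
- have /eqP : (4 ^ l = 4 ^ i)%N by lia.
  by rewrite eqn_exp2l // => /eqP ->.
- have /eqP : (4 ^ i = 4 ^ j)%N by lia.
  by rewrite eqn_exp2l // (negPf ij).
- by congr _.+1; apply: (IH j l m) ij; lia.
Qed.

(** * The two generators *)

Section CommutatorOverlap.
Variable X : topologicalType.
Implicit Types g h u v w : homeo X X.

(* No point outside W is moved by both g and h, so there they commute. *)
Lemma comm_overlap (W : set X) g h u v :
  (forall x, ~ W x -> u x = x) -> (forall x, ~ W x -> v x = x) ->
  (forall x, W x -> g x = u x) -> (forall x, W x -> h x = v x) ->
  (forall x, ~ W x -> g x = x \/ h x = x) ->
  g * h * g^-1 * h^-1 = u * v * u^-1 * v^-1.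
Proof.
have stab w : (forall x, ~ W x -> w x = x) -> forall x, W x -> W (w x) /\ W (w^-1 x).
  move=> wf x Wx; split; apply: contrapT => nW.
    by have /homeo_inj wx := wf _ nW; rewrite wx in nW.
  by have := wf _ nW; rewrite homeoKV => wx; rewrite -wx in nW.
have inv w w' : (forall x, ~ W x -> w' x = x) -> (forall x, W x -> w x = w' x) ->
    forall x, W x -> w^-1 x = w'^-1 x.
  move=> wf ww' x Wx; apply: homeoV_eq.
  by rewrite ww' ?homeoKV //; case: (stab _ wf _ Wx).
have stabC w w' : (forall x, ~ W x -> w' x = x) -> (forall x, W x -> w x = w' x) ->
    forall x, ~ W x -> ~ W (w x) /\ ~ W (w^-1 x).
  move=> wf ww' x nWx; split=> Wx; apply: nWx.
    have [_] := stab _ wf _ Wx.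
    by rewrite -(inv _ _ wf ww' _ Wx) homeoVK.
  have [+ _] := stab _ wf _ Wx.
  by rewrite -ww' // homeoKV.
move=> uf vf gu hv gh; apply: homeo_ext => x; rewrite !homeoM.
have [Wx|nWx] := pselect (W x).
  have [_ W1] := stab _ vf _ Wx; rewrite (inv _ _ vf hv) //.
  have [_ W2] := stab _ uf _ W1; rewrite (inv _ _ uf gu) //.
  have [W3 _] := stab _ vf _ W2; rewrite hv //.
  by have [W4 _] := stab _ uf _ W3; rewrite gu.
have vVx : v^-1 x = x by apply: homeoV_eq; exact: vf.
have uVx : u^-1 x = x by apply: homeoV_eq; exact: uf.
rewrite vVx uVx vf // uf //.
have [_ n1] := stabC _ _ vf hv _ nWx.
have [_ n2] := stabC _ _ uf gu _ n1.
suff /(_ _ n2) -> : forall z, ~ W z -> g (h z) = h (g z) by rewrite !homeoKV.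
move=> z nz; have [gz|hz] := gh _ nz.
  rewrite gz; have [hz _] := stabC _ _ vf hv _ nz.
  have [//|/homeo_inj hhz] := gh _ hz; by rewrite hhz.
rewrite hz; have [gz _] := stabC _ _ uf gu _ nz.
have [/homeo_inj ggz|//] := gh _ gz; by rewrite ggz.
Qed.

End CommutatorOverlap.

Section Tower.
Variables (X : topologicalType) (a : homeo X X) (W : set X) (n : nat).
Variable f : 'I_n -> homeo X X.
Hypothesis fW : forall i x, ~ W x -> f i x = x.
Hypothesis tower : forall i j x y, (i < 4 ^ n)%N -> (j < 4 ^ n)%N -> W x -> W y ->
  (a ^+ i) x = (a ^+ j) y -> i = j.

Definition tower_gen : homeo X X :=
  \prod_(i < n) (a ^+ (4 ^ i) * f i * a ^- (4 ^ i)).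

Lemma tower_gen_in (N : set (homeo X X)) : subgroup N -> N a ->
  (forall i, N (f i)) -> N tower_gen.
Proof.
move=> sN Na Nf; rewrite /tower_gen.
elim/big_ind: _ => [|g h Ng Nh|i _]; first exact: subgroup1.
  exact: subgroupM.
by apply: subgroup_conj => //; exact: subgroupX.
Qed.

Let exp4_lt (i : 'I_n) : (4 ^ i < 4 ^ n)%N.
Proof. by rewrite ltn_exp2l. Qed.

(** The commutator argument compares levels whose heights are sums of two exponents; a tower of
    height [4 ^ n] contains them. *)
Let exp4_lt2 (i j : 'I_n) : (4 ^ i + 4 ^ j < 4 ^ n)%N.
Proof.
suff aux (k p q : nat) : (p < k)%N -> (q < k)%N -> (4 ^ p + 4 ^ q < 4 ^ k)%N.
  exact: aux.
case: k => // k; rewrite !ltnS => pk qk.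
have := leq_pexp2l (isT : 0 < 4)%N pk; have := leq_pexp2l (isT : 0 < 4)%N qk.
by rewrite expnS; have := expn_gt0 4 k; lia.
Qed.

Let tower_genE (i : 'I_n) x : W x -> tower_gen ((a ^+ (4 ^ i)) x) = (a ^+ (4 ^ i)) (f i x).
Proof.
move=> Wx; rewrite /tower_gen.
have conjE (j : 'I_n) y : (a ^+ (4 ^ j) * f j * a ^- (4 ^ j)) ((a ^+ (4 ^ j)) y) =
    (a ^+ (4 ^ j)) (f j y) by rewrite !homeoM homeoVK.
have conjN j (k : 'I_n) y : j != k -> W y -> (a ^+ (4 ^ j) * f j * a ^- (4 ^ j))
    ((a ^+ (4 ^ k)) y) = (a ^+ (4 ^ k)) y.
  move=> jk Wy; rewrite !homeoM fW ?homeoKV //.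
  move=> Wz; have /esym : (a ^+ (4 ^ j)) ((a ^- (4 ^ j)) ((a ^+ (4 ^ k)) y)) =
    (a ^+ (4 ^ k)) y by rewrite homeoKV.
  move=> /(tower (exp4_lt k) (exp4_lt j) Wy Wz)/eqP.
  by rewrite eqn_exp2l // => /eqP/val_inj kj; rewrite kj eqxx in jk.
have Wf j y : W y -> W (f j y).
  move=> Wy; apply: contrapT => nW.
  by have /homeo_inj E := fW j nW; rewrite E in nW.
(* By disjointness of the levels, only the factor [i] can move points of level [4 ^ i], and it
   occurs at most once in a duplicate-free list. *)
suff aux (s : seq 'I_n) : uniq s ->
    (i \in s -> (\prod_(j <- s) (a ^+ (4 ^ j) * f j * a ^- (4 ^ j)))
      ((a ^+ (4 ^ i)) x) = (a ^+ (4 ^ i)) (f i x)) /\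
    (i \notin s -> (\prod_(j <- s) (a ^+ (4 ^ j) * f j * a ^- (4 ^ j)))
      ((a ^+ (4 ^ i)) x) = (a ^+ (4 ^ i)) x).
  by have [+ _] := aux _ (index_enum_uniq _); apply; exact: mem_index_enum.
elim: s => [|j s IH]; first by rewrite big_nil.
rewrite /= => /andP[js us]; have [IH1 IH2] := IH us.
rewrite big_cons inE negb_or; split.
  move=> /orP[/eqP ij|si]; first by rewrite homeoM IH2 ij // conjE.
  rewrite homeoM IH1 // conjN //; last exact: Wf.
  by apply: contraNneq js => ->.
by move=> /andP[ij si]; rewrite homeoM IH2 // conjN // eq_sym.
Qed.

Let tower_genN y : (forall i x, W x -> y <> (a ^+ (4 ^ (i : 'I_n))) x) ->
  tower_gen y = y.
Proof.
move=> yW; rewrite /tower_gen; elim: (index_enum _) => [|j s IH].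
  by rewrite big_nil.
rewrite big_cons homeoM IH !homeoM fW ?homeoKV // => Wz.
by apply: (yW j _ Wz); rewrite homeoKV.
Qed.

(** On [W] the conjugate [g k] agrees with [f k]. If [g i] and [g j] both move [x], then [x] is
    carried to the level [4^l] by [a^(4^i)] and to the level [4^m] by [a^(4^j)]. Comparing heights
    gives [4^j + 4^l = 4^i + 4^m], hence [l = i] and [x] lies in [W]. *)
Lemma tower_comm (N : set (homeo X X)) (i j : 'I_n) : subgroup N -> N a -> N tower_gen ->
  i != j -> N (f i * f j * (f i)^-1 * (f j)^-1).
Proof.
move=> sN Na Nb ij.
pose g (k : 'I_n) := a ^- (4 ^ k) * tower_gen * a ^+ (4 ^ k).
have Ng k : N (g k).
  rewrite /g; apply: subgroupM => //; last exact: subgroupX.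
  by apply: subgroupM => //; apply: subgroupV => //; exact: subgroupX.
suff <- : g i * g j * (g i)^-1 * (g j)^-1 = f i * f j * (f i)^-1 * (f j)^-1.
  exact: subgroup_comm.
have gW k x : W x -> g k x = f k x.
  by move=> Wx; rewrite /g !homeoM tower_genE // homeoVK.
have gN k x : g k x <> x -> exists (l : 'I_n) w, W w /\ (a ^+ (4 ^ k)) x = (a ^+ (4 ^ l)) w.
  move=> gx; apply: contrapT => nl; apply: gx.
  rewrite /g !homeoM tower_genN ?homeoVK // => l w Ww aw; apply: nl.
  by exists l, w.
apply: (@comm_overlap _ W); [exact: fW|exact: fW|exact: gW|exact: gW|] => x nWx.
apply: contrapT => /not_orP[/gN[l [w [Ww il]]] /gN[m [v [Wv jm]]]].
apply: nWx.
have E : (a ^+ (4 ^ j + 4 ^ l)) w = (a ^+ (4 ^ i + 4 ^ m)) v.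
  by rewrite !homeoXD -il -jm homeoXC.
have /sidon_exp4 := tower (exp4_lt2 _ _) (exp4_lt2 _ _) Ww Wv E.
by move=> /(_ ij)/val_inj li; move: il; rewrite li => /homeo_inj ->.
Qed.

End Tower.

Section TwoGenerators.
Variables (X : topologicalType) (P : (X -> X) -> X -> Prop).
Hypothesis germP : germ_axioms P.
Hypotheses (cX : compact [set: X]) (hX : hausdorff_space X).
Hypothesis basisX : clopen_basis X.
Hypothesis minimalP : forall x V, open V -> V !=set0 -> exists f, P f x /\ V (f x).
Hypothesis infiniteP : forall Z, clopen Z -> exists f g,
  [/\ iso P Z f, iso P Z g, forall x, Z x -> Z (f x), forall x, Z x -> Z (g x) &
      forall x y, Z x -> Z y -> f x <> g y].
Variables (J : finType) (D : J -> set X) (b : J -> X -> X) (j0 : J).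
Hypotheses (Db : forall j, iso P (D j) (b j)) (D0 : D j0 = setT) (b0 : b j0 = id).
Hypothesis expansiveP : forall U s x, open U -> U x -> (forall y, U y -> P s y) ->
  exists V w, [/\ word D b V w, open V, V x, V `<=` U & forall y, V y -> w y = s y].
Variable x0 : X.
Implicit Types (U V W : set X) (N : set (homeo X X)) (g h : homeo X X).

Definition alternating : set (homeo X X) := subgroup_gen
  [set g | exists U f0 f1 f2, triple P U f0 f1 f2 /\ is_cycle3 U f0 f1 f2 g].

Lemma alternating_subgroup : subgroup alternating.
Proof. exact: subgroup_gen_subgroup. Qed.

Lemma alternating_cycle3 U f0 f1 f2 g :
  triple P U f0 f1 f2 -> is_cycle3 U f0 f1 f2 g -> alternating g.
Proof. by move=> t c N [_]; apply; exists U, f0, f1, f2. Qed.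

Lemma alternating_full : full P alternating setT.
Proof.
move=> U f0 f1 f2 t _; have [g gc _] := cycle3_exists germP cX hX t.
by exists g => //; exact: alternating_cycle3 gc.
Qed.

Lemma full_alternating N : subgroup N -> full P N setT -> alternating `<=` N.
Proof.
move=> sN fN g gA; apply: (gA N); split=> // h [U [f0 [f1 [f2 [t hc]]]]].
by have [//|k Nk kc] := fN _ _ _ _ t; rewrite (is_cycle3_uniq hc kc).
Qed.

Lemma alternating_germ g : alternating g -> forall x, P g x.
Proof.
move=> gA; apply: (gA [set h : homeo X X | forall x, P h x]); split; first split.
- exact: germ_id.
- by move=> h k Ph Pk x; exact: (germ_comp germP (Pk x) (Ph _)).
- by move=> h; exact: homeo_inv_germ.
move=> h [U [f0 [f1 [f2 [t hc]]]]].
have [k kc Pk] := cycle3_exists germP cX hX t.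
by rewrite (is_cycle3_uniq hc kc).
Qed.

(* W is linked to its translate by a^K and to the one by a^(K+1), hence to the one
   by a, since the latter meets the translate by a^(K+1). *)
Lemma full_chain N (a : homeo X X) W K : subgroup N -> (N `<=` alternating) ->
  N a -> full P N W -> clopen W ->
  W `&` ((a ^+ K) @` W) !=set0 -> W `&` ((a ^+ K.+1) @` W) !=set0 ->
  (forall x, exists2 i, (i <= K)%N & ((a ^+ i) @` W) x) -> full P N setT.
Proof.
move=> sN NA Na fW cW WK WK1 cover.
have germN g : N g -> forall x, P g x by move=> /NA; exact: alternating_germ.
have cT g V : N g -> clopen V -> clopen (g @` V).
  move=> Ng cV; apply: (iso_image_clopen germP cX hX (f := g)); split=> //.
    by move=> x y _ _ /homeo_inj.
  by move=> x _; exact: germN.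
have Nai i : N (a ^+ i) by exact: subgroupX.
have fT i V : full P N V -> full P N ((a ^+ i) @` V).
  by move=> fV; exact: (full_translate germP sN germN).
have fU V V' := @fullU _ _ germP cX hX basisX minimalP infiniteP N sN germN V V'.
pose V1 := W `|` (a ^+ K) @` W.
pose V2 := V1 `|` (a ^+ K.+1) @` W.
pose V3 := V2 `|` a @` W.
have cV1 : clopen V1 by apply: clopenU => //; exact: cT.
have cV2 : clopen V2 by apply: clopenU => //; exact: cT.
have cV3 : clopen V3 by apply: clopenU => //; exact: cT.
have f1 : full P N V1 by apply: fU => //; [exact: cT|exact: fT].
have f2 : full P N V2.
  apply: fU => //; [exact: cT| |exact: fT].
  by have [x [Wx ax]] := WK1; exists x; split=> //; left.
have f3 : full P N V3.
  apply: fU => //; [exact: cT| |exact: (fT 1%N)].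
  have [x [Wx [y Wy yx]]] := WK; exists (a x); split; last by exists x.
  by right; exists y => //; rewrite homeoXS yx.
have [w Ww] : W !=set0 by have [x [Wx _]] := WK; exists x.
(* [V3] contains [W] and its translate by [a], so consecutive translates of [V3] share a translate
   of [W]. *)
have H n : full P N (\bigcup_(i < n.+1) ((a ^+ i) @` V3)) /\
    clopen (\bigcup_(i < n.+1) ((a ^+ i) @` V3)).
  elim: n => [|n [IHf IHc]].
    rewrite (_ : \bigcup_(i < 1) _ = V3) //.
    apply/seteqP; split=> [x [[|i] //= _ [y Vy <-//]]|x Vx].
    by exists 0%N => //; exists x.
  have -> : \bigcup_(i < n.+2) ((a ^+ i) @` V3) =
      (\bigcup_(i < n.+1) ((a ^+ i) @` V3)) `|` (a ^+ n.+1) @` V3.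
    apply/seteqP; split=> [x [i /= lti ix]|x [[i /= lti ix]|nx]].
    - have [ltin|] := ltnP i n.+1; first by left; exists i.
      move=> lein; right; suff <- : i = n.+1 by [].
      by apply/eqP; rewrite eqn_leq lein andbT -ltnS.
    - by exists i => //=; exact: ltnW.
    - by exists n.+1 => /=.
  have cn : clopen ((a ^+ n.+1) @` V3) by exact: cT.
  split; last exact: clopenU.
  apply: fU => //; last exact: fT.
  exists ((a ^+ n.+1) w); split; last by exists w => //; left; left; left.
  exists n => //=; exists (a w); first by right; exists w.
  by rewrite -[in LHS](expg1 a) -homeoXD addn1.
apply: full_sub (H K).1 => x _; have [i iK [y Wy <-]] := cover x.
by exists i => //=; exists y => //; left; left; left.
Qed.

Lemma clopen_bigcup_lt (F : nat -> set X) n : (forall i, clopen (F i)) ->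
  clopen (\bigcup_(i < n) F i).
Proof.
move=> cF; elim: n => [|n IH].
  rewrite (_ : \bigcup_(i < 0) _ = set0); first exact: clopen0.
  by apply/seteqP; split=> // x [].
rewrite (_ : \bigcup_(i < n.+1) _ = (\bigcup_(i < n) F i) `|` F n).
  exact: clopenU.
apply/seteqP; split=> [x [i /= lti Fx]|x [[i /= lti Fx]|Fx]].
- have [ltin|lein] := ltnP i n; first by left; exists i.
  by right; have -> : n = i by apply/eqP; rewrite eqn_leq lein -ltnS.
- by exists i => //=; exact: ltnW.
- by exists n => /=.
Qed.

Theorem alternating_two_generated : two_generated alternating.
Proof.
have sA := alternating_subgroup; have fA := alternating_full.
(* Five copies carry the cycles; copies 5 and 6, named [C0] and [Z0] below, serve to build the
   translation. *)
have [e [Ie _ ei]] := iso_copies germP infiniteP 7 (@clopenT X).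
have eiT i j x y ltin ltjn : e i x = e j y -> i = j /\ x = y := ei i j x y ltin ltjn I I.
pose e5 (i : 'I_5) := e i.
have lt7 (i : 'I_5) : (i < 7)%N by rewrite (leq_trans (ltn_ord i)).
have Ie5 i : iso P setT (e5 i) by exact: Ie.
have ei5 (i j : 'I_5) x y : e5 i x = e5 j y -> i = j /\ x = y.
  by move=> /(eiT _ _ _ _ (lt7 i) (lt7 j))[/val_inj].
have eN5 (i j : 'I_5) x y : i != j -> e5 i x <> e5 j y.
  by move=> ij /ei5[] /eqP; rewrite (negPf ij).
have cE i : (i < 7)%N -> clopen (e i @` setT).
  by move=> lti; exact: (iso_image_clopen germP cX hX (Ie i lti)).
pose W := \bigcup_i (e5 i @` setT).
have cW : clopen W.
  rewrite (_ : W = \bigcup_(i < 5) (if (i < 7)%N then e i @` setT else set0)).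
    by apply: clopen_bigcup_lt => i; case: ifP => [/cE//|_]; exact: clopen0.
  apply/seteqP; split=> [x [i _ ix]|x [i /= lti]].
    by exists i => /=; [exact: ltn_ord|rewrite lt7].
  by rewrite ifT; [exists (Ordinal lti)|rewrite (leq_trans lti)].
pose I := (J * 'I_5 * 'I_5 * 'I_5)%type.
(* Indices with repeated copies get the identity, so that [f] is defined on the whole finite type
   [I]. *)
have /choice[f fP] (t : I) : exists g, let: (j, i, k, l) := t in
    [/\ alternating g, forall x, ~ W x -> g x = x &
    uniq [:: i; k; l] -> is_cycle3 (D j) (e5 i) (e5 k \o b j) (e5 l) g].
  case: t => [[[j i] k] l].
  have [u|nu] := boolP (uniq [:: i; k; l]); last first.
    by exists 1; split; [exact: subgroup1| |].
  have /and3P[] : [&& i != k, i != l & k != l].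
    by move: u; rewrite /= !inE negb_or andbT -andbA.
  move=> ik il kl; have Dj := Db j.
  have tr : triple P (D j) (e5 i) (e5 k \o b j) (e5 l).
    have [cDj bi _] := Dj; split.
    - exact: isoS (Ie5 i) cDj _.
    - exact: (iso_comp germP Dj (Ie5 k)).
    - exact: isoS (Ie5 l) cDj _.
    - move=> x y Dx Dy; rewrite /comp; split; [by case/ei5|by case/ei5 => _ /bi; auto|by case/ei5|].
      by split; exact: eN5.
  have [g gc _] := cycle3_exists germP cX hX tr.
  exists g; split=> //; first exact: alternating_cycle3 gc.
  move=> x nWx; case: gc => _ _ _; apply => y Dy.
  by split=> xE; apply: nWx; rewrite xE; [exists i|exists k|exists l].
pose n := #|{: I}|.
pose K := (4 ^ n)%N.
have K0 : (0 < K)%N by rewrite expn_gt0.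
pose C0 := e 5 @` setT; pose Z0 := e 6 @` setT.
have WC0 x : W x -> ~ C0 x.
  move=> [i _ [y _ <-]] [z _ /eiT[]// /eqP]; rewrite eq_sym.
  by move=> /eqP ii; have := ltn_ord i; rewrite ii.
have WZ0 x : W x -> ~ Z0 x.
  move=> [i _ [y _ <-]] [z _ /eiT[]// /eqP]; rewrite eq_sym.
  by move=> /eqP ii; have := ltn_ord i; rewrite ii.
have CZ0 x : C0 x -> ~ Z0 x by move=> [y _ <-] [z _ /eiT[]].
have We i x : (i < 5)%N -> W (e i x).
  by move=> lti; exists (Ordinal lti) => //; exists x.
(* [a0] sends everything outside [Z0] into [C0], which is disjoint from [Z0] and from [W]. So [W]
   enters [C0] after one step and stays there, and by injectivity its translates are pairwise
   disjoint. *)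
have [a0 [Aa0 a0C _]] : exists g, [/\ alternating g, forall x, (~` Z0) x -> C0 (g x) &
    forall x, ~ setT x -> g x = x].
  apply: (vigorous germP cX basisX minimalP infiniteP sA fA) => //.
  - exact: clopenT.
  - by apply: (clopenC set0); exact: cE.
  - by exists (e 6 x0); split=> //; apply; exists x0.
  - exact: cE.
  - by exists (e 5 x0); exists x0.
have a0S i w : W w -> C0 ((a0 ^+ i.+1) w).
  move=> Ww; elim: i => [|i IH]; first by rewrite expg1; apply/a0C/WZ0.
  by rewrite homeoXS; apply/a0C/CZ0.
have a0le i j x y : W x -> W y -> (i <= j)%N -> (a0 ^+ i) x = (a0 ^+ j) y -> i = j.
  move=> Wx Wy ij; rewrite -(subnKC ij) homeoXD => /homeo_inj xE.
  move: xE; case E : (j - i)%N => [|d] xE; first by rewrite addn0.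
  by case: (WC0 x Wx); rewrite xE; exact: a0S.
have a0T i j x y : W x -> W y -> (a0 ^+ i) x = (a0 ^+ j) y -> i = j.
  move=> Wx Wy xy; have [ij|ji] := leqP i j; first exact: a0le xy.
  by apply/esym; apply: (a0le _ _ y x Wy Wx _ (esym xy)); exact: ltnW.
have cT (g : homeo X X) V : alternating g -> clopen V -> clopen (g @` V).
  move=> Ag cV; apply: (iso_image_clopen germP cX hX (f := g)); split=> //.
    by move=> x y _ _ /homeo_inj.
  by move=> x _; exact: alternating_germ.
(* The iterates of W under a0 are disjoint for all exponents, but need not cover X:
   the remainder Y is absorbed by modifying a0 above level K - 1. *)
pose L := \bigcup_(i < K) ((a0 ^+ i) @` W).
have cL : clopen L.
  by apply: clopen_bigcup_lt => i; apply: cT => //; exact: (subgroupX sA).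
pose Y := ~` L.
have cY : clopen Y by exact: (clopenC set0).
pose V := W `|` Y.
have cV : clopen V by exact: clopenU.
have WL : W `<=` L by move=> x Wx; exists 0%N => //; exists x.
have KY w : W w -> Y ((a0 ^+ K) w).
  by move=> Ww [i /= iK [v Wv /(a0T _ _ _ _ Wv Ww) iE]]; rewrite iE ltnn in iK.
(* Only copy 0 inside level [K] is reserved for [Y]; the points of level [K] outside it return to
   [W] under [q^-1], which creates the overlaps. *)
pose C := (a0 ^+ K) @` (e 0 @` setT).
have CW x : C x -> exists2 u, W u & x = (a0 ^+ K) u.
  by move=> [_ [y _ <-] <-]; exists (e 0 y) => //; exact: We.
have [q [Aq qY qV]] : exists g, [/\ alternating g, forall x, Y x -> C (g x) &
    forall x, ~ V x -> g x = x].
  apply: (vigorous germP cX basisX minimalP infiniteP sA) => //.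
  - exact: full_sub fA.
  - by move=> x; right.
  - by exists (e 0 x0); split; [left; exact: We|apply; apply/WL/We].
  - by apply: cT; [exact: (subgroupX sA)|exact: cE].
  - by move=> x /CW[u Wu ->]; right; exact: KY.
  - by exists ((a0 ^+ K) (e 0 x0)); exists (e 0 x0) => //; exists x0.
have qVV x : V x -> V (q^-1 x).
  move=> Vx; apply: contrapT => nV; have := qV _ nV.
  by rewrite homeoKV => xE; rewrite -xE in nV.
have qVW x : V x -> ~ C x -> W (q^-1 x).
  move=> Vx nC; have [//|Yx] := qVV _ Vx; case: nC.
  by have := qY _ Yx; rewrite homeoKV.
(* a agrees with a0 on the first K - 1 levels of the tower; q^-1 folds the K-th
   level back onto Y and part of W. *)
pose a : homeo X X := q^-1 * a0.
have Aa : alternating a by apply: (subgroupM sA) => //; exact: (subgroupV sA).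
have aE i w : (i < K)%N -> W w -> (a ^+ i) w = (a0 ^+ i) w.
  move=> + Ww; elim: i => [//|i IH] iK; rewrite [in LHS]homeoXS IH ?(ltnW iK) //.
  rewrite homeoM -homeoXS; apply: homeoV_eq; apply: qV => -[/WC0|]; apply.
    exact: a0S.
  by exists i.+1 => //; exists w.
have aK w : W w -> (a ^+ K) w = q^-1 ((a0 ^+ K) w).
  move=> Ww; rewrite -[in LHS](prednK K0) homeoXS aE ?prednK //.
  by rewrite homeoM -homeoXS prednK.
have aY y : Y y -> exists2 u, W u & (a ^+ K) u = y.
  move=> Yy; have [u Wu uE] := CW _ (qY _ Yy); exists u => //.
  by rewrite aK // -uE homeoVK.
have tow i j x y : (i < K)%N -> (j < K)%N -> W x -> W y ->
    (a ^+ i) x = (a ^+ j) y -> i = j.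
  by move=> iK jK Wx Wy; rewrite !aE //; exact: a0T.
pose ff (k : 'I_n) := f (enum_val k).
have ffW k x : ~ W x -> ff k x = x.
  by rewrite /ff; case: (enum_val k) (fP (enum_val k)) => [[[j i] k'] l] [_ + _]; apply.
pose bb := tower_gen a ff.
have Abb : alternating bb.
  apply: tower_gen_in => // k; rewrite /ff.
  by case: (enum_val k) (fP (enum_val k)) => [[[j i] k'] l] [].
pose N := subgroup_gen [set a; bb].
have sN : subgroup N by exact: subgroup_gen_subgroup.
have Na : N a by move=> M [_]; apply; left.
have Nbb : N bb by move=> M [_]; apply; right.
have NA : N `<=` alternating by move=> g; apply; split=> // _ [->|->].
have germN g : N g -> forall x, P g x by move=> /NA; exact: alternating_germ.
have Nf (t t' : I) : t != t' -> N (f t * f t' * (f t)^-1 * (f t')^-1).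
  move=> tt'; have := tower_comm ffW tow (i := enum_rank t) (j := enum_rank t') sN Na Nbb.
  rewrite /ff !enum_rankK; apply.
  by rewrite (inj_eq enum_rank_inj).
(* Each generator is a commutator of two distinct ones. *)
have NT j i k l : uniq [:: i; k; l] -> cycle3_in N (D j) (e5 i) (e5 k \o b j) (e5 l).
  move=> u; have [m [p um]] := extend_uniq3 u.
  move: um; rewrite /= !inE !negb_or -!andbA.
  case/and5P=> pm pi pk pl; case/and5P=> mi mk ml ik; rewrite andbT => /andP[il kl].
  have [_ _ c1] := fP (j, i, k, m); have [_ _ c2] := fP (j0, i, l, p).
  exists (f (j, i, k, m) * f (j0, i, l, p) * (f (j, i, k, m))^-1 * (f (j0, i, l, p))^-1).
    by apply: Nf; apply/eqP => -[_ kl' _]; rewrite kl' eqxx in kl.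
  have -> : e5 l = e5 l \o b j0 by rewrite b0.
  rewrite -[D j]setIT -D0; apply: is_cycle3_comm (c1 _) (c2 _) _.
  - by rewrite /= !inE negb_or ik andbT /= eq_sym mi eq_sym mk.
  - by rewrite /= !inE negb_or il andbT /= eq_sym pi eq_sym pl.
  rewrite /comp; move=> x y _ _; split; [by case/ei5|exact: eN5| | |];
    do ?split; apply: eN5; by rewrite // eq_sym.
have fW : full P N W.
  exact: (full_spread germP cX hX basisX Db D0 b0 expansiveP Ie5 ei5 sN germN NT).
have fN : full P N setT.
  apply: (full_chain sN NA Na fW cW (K := K)).
  (* As [e 1 x0] is outside copy 0, its image under [a0 ^+ K] lies in [Y] but not in [C], so [q^-1]
     sends it into [W]. *)
  - exists ((a ^+ K) (e 1%N x0)); split; last by exists (e 1%N x0) => //; exact: We.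
    rewrite aK; last exact: We.
    apply: qVW; first by right; apply/KY/We.
    by move=> [_ [y _ <-] /homeo_inj/eiT[]].
  (* The point [e 6 x0] of [Z0] lies in [Y], so it is the image under [a ^+ K] of some [u] in [W].
     Its image under [a0] is in [V] and not in [C], for otherwise cancelling [a0] would put [e 6 x0]
     on a level below [K]. Hence [q^-1] sends that image into [W]. *)
  - have Yz : Y (e 6 x0).
      move=> [[|i] /= iK [w Ww]]; last first.
        by move=> wE; apply: (CZ0 _ (a0S i w Ww)); rewrite wE; exists x0.
      by move=> wE; apply: (WZ0 _ Ww); exists x0 => //; rewrite -wE.
    have [u Wu uE] := aY _ Yz.
    exists (a (e 6 x0)); split; last by exists u => //; rewrite homeoXS uE.
    rewrite homeoM; apply: qVW.
      apply: contrapT => /not_orP[nW] /contrapT[[|i] /= iK [w Ww]].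
        by move=> wE; apply: nW; rewrite -wE.
      by rewrite homeoXS => /homeo_inj wE; apply: Yz; exists i; [exact: ltnW|exists w].
    move=> /CW[v Wv]; rewrite -(prednK K0) homeoXS => /homeo_inj vE.
    by apply: Yz; exists K.-1; [rewrite /= prednK|exists v].
  - move=> x; have [[i /= iK [w Ww <-]]|Yx] := pselect (L x).
      by exists i; [exact: ltnW|exists w => //; rewrite aE].
    by have [u Wu uE] := aY _ Yx; exists K => //; exists u.
exists a, bb; split=> //; apply/seteqP; split; first exact: NA.
exact: full_alternating.
Qed.
End TwoGenerators.

(** * The pseudogroup of an etale groupoid *)

Section Continuity.

Lemma continuous_at_near_eq (Y Z : topologicalType) (u v : Y -> Z) (y : Y) :
  {for y, continuous u} -> nbhs y [set z | u z = v z] -> {for y, continuous v}.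
Proof.
move=> cu uv N vN; have uN : nbhs y (u @^-1` N).
  by apply: cu; rewrite [u y](nbhs_singleton uv).
have : nbhs y (v @^-1` N) by apply: filterS2 uN uv => z /= + <-.
by [].
Qed.

Lemma continuous_at_comp (Y Z T : topologicalType) (u : Y -> Z) (v : Z -> T) (y : Y) :
  {for y, continuous u} -> {for u y, continuous v} -> {for y, continuous (v \o u)}.
Proof. exact: continuous_comp. Qed.

Lemma continuous_at_set_type (Y Z : topologicalType) (A : set Z) (u : Y -> A) (y : Y) :
  {for y, continuous (fun z => \val (u z))} -> {for y, continuous u}.
Proof.
move=> cu N [_ [[B oB <-] /= By BN]].
have uB : nbhs y ((fun z => \val (u z)) @^-1` B).
  by apply: cu; exact: open_nbhs_nbhs.
have : nbhs y (u @^-1` N) by apply: filterS uB => z Bz; exact: BN.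
by [].
Qed.

Lemma set_type_val_continuous (Z : topologicalType) (A : set Z) :
  continuous (fun a : A => \val a).
Proof. exact: initial_continuous. Qed.

Lemma gmul_continuous_at (G : topologicalGroupoidType) (Y : topologicalType)
    (u v : Y -> G) (y : Y) :
  {for y, continuous u} -> {for y, continuous v} ->
  nbhs y [set z | gdom (u z) = gcod (v z)] ->
  {for y, continuous (fun z => gmul (u z) (v z))}.
Proof.
move=> cu cv uv N; have uvy := nbhs_singleton uv.
pose p : @composable G := exist _ (u y, v y) (mem_set uvy).
move=> /(gmul_continuous p)[_ [[B oB <-] /= Bp BN]].
have nB : nbhs (u y, v y) B by exact: open_nbhs_nbhs.
have cuv : (fun z => (u z, v z)) @ y --> (u y, v y) by exact: cvg_pair.
have yB : nbhs y ((fun z => (u z, v z)) @^-1` B) by exact: cuv.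
have : nbhs y ((fun z => gmul (u z) (v z)) @^-1` N).
  by apply: filterS2 uv yB => z uvz Bz; exact: (BN (exist _ (u z, v z) (mem_set uvz))).
by [].
Qed.

(** Trades the homeomorphism of subspaces for a total map [r] whose continuity is stated in the
    ambient space, which is possible because [V] is open; [y0] is the value of [r] off [V]. *)
Lemma restricts_to_homeo_section (Y Z : topologicalType) (f : Y -> Z) A V (y0 : Y) :
  open V -> restricts_to_homeo f A V -> exists r : Z -> Y,
    [/\ forall z, V z -> [/\ {for z, continuous r}, A (r z) & f (r z) = z] &
        forall a, A a -> V (f a) /\ r (f a) = a].
Proof.
move=> oV [h hf].
have hV z : exists y, forall Vz : V z, y = \val (homeo_inv h (exist _ z (mem_set Vz))).
  have [Vz|nVz] := pselect (V z); last by exists y0.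
  exists (\val (homeo_inv h (exist _ z (mem_set Vz)))) => Vz'.
  by rewrite (Prop_irrelevance Vz Vz').
have [r rE] := choice hV.
have rV z : V z -> A (r z) /\ f (r z) = z.
  move=> Vz; rewrite (rE _ Vz) -hf homeo_invK; split=> //.
  exact: set_valP.
have rA a : A a -> V (f a) /\ r (f a) = a.
  move=> Aa; pose a' : A := exist _ a (mem_set Aa).
  have Va : V (f a) by rewrite -[a]/(\val a') -hf; exact: set_valP.
  split=> //; rewrite (rE _ Va).
  suff -> : exist _ (f a) (mem_set Va) = h a' by rewrite homeo_funK.
  by apply: val_inj; rewrite hf.
exists r; split=> // z Vz; have [Az fz] := rV z Vz; split=> // N.
rewrite (rE _ Vz) => rN.
have c : {for (exist _ z (mem_set Vz) : V), continuous (fun a : V => \val (homeo_inv h a))}.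
  apply: continuous_at_comp; first exact: homeo_inv_continuous.
  exact: set_type_val_continuous.
have [_ [[B oB <-] /= Bz BN]] := c _ rN.
have nBV : nbhs z (B `&` V) by apply: open_nbhs_nbhs; split=> //; exact: openI.
have : nbhs z (r @^-1` N).
  apply: filterS nBV => w [Bw Vw]; rewrite /preimage /= (rE _ Vw).
  exact: (BN (exist _ w (mem_set Vw))).
by [].
Qed.

End Continuity.

Section Germ.
Variable G : topologicalGroupoidType.
Local Notation X := (units G).
Hypothesis etaleG : etale G.
Implicit Types (f g : X -> X) (s t : X -> G) (x y z : X) (O N : set X).

(* Germs are described by continuous sections of the source map instead of
   bisections: in an etale groupoid the image of such a section is open, and
   sections compose without knowing that products of bisections are bisections. *)
Definition local_section O s f : Prop := forall y, O y ->
  [/\ {for y, continuous s}, src (s y) = y & rng (s y) = f y].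

Definition germ f x : Prop :=
  exists O s, [/\ open O, O x & local_section O s f].

Lemma unit_gdom x : gdom (\val x) = \val x.
Proof. by case: x => /= x /set_mem[y _ <-]; rewrite gdom_dom. Qed.

Lemma unit_gcod x : gcod (\val x) = \val x.
Proof. by case: x => /= x /set_mem[y _ <-]; rewrite gcod_dom. Qed.

Lemma gcod_continuous : continuous (@gcod G).
Proof.
move=> c; have -> : @gcod G = fun d => gmul d (ginv d).
  by apply: funext => d; rewrite gmulxV.
apply: gmul_continuous_at; [exact: cvg_id|exact: ginv_continuous|].
by apply: filterS filterT => d _ /=; rewrite gcod_inv.
Qed.

Lemma gdom_continuous : continuous (@gdom G).
Proof.
have -> : @gdom G = @gcod G \o @ginv G by apply: funext => d; rewrite /= gcod_inv.
move=> c; apply: continuous_at_comp; first exact: ginv_continuous.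
exact: gcod_continuous.
Qed.

Lemma src_continuous : continuous (@src G).
Proof. by move=> c; apply: continuous_at_set_type; exact: gdom_continuous. Qed.

Lemma rng_continuous : continuous (@rng G).
Proof. by move=> c; apply: continuous_at_set_type; exact: gcod_continuous. Qed.

Lemma local_homeomorphism_section (p : G -> X) (c : G) : local_homeomorphism p ->
  exists A V (r : X -> G), [/\ open A, A c, open V,
    forall z, V z -> [/\ {for z, continuous r}, A (r z) & p (r z) = z] &
    forall a, A a -> V (p a) /\ r (p a) = a].
Proof.
move=> /(_ c)[A [V [oA Ac oV AV]]].
by have [r [rV rA]] := restricts_to_homeo_section c oV AV; exists A, V, r.
Qed.

(** Sections have open image: the source map is injective near [s x], so an arrow close to [s x] is
    the value of [s] at its own source. *)
Lemma local_section_near O s f x : open O -> O x -> local_section O s f ->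
  nbhs (s x) [set c | O (src c) /\ s (src c) = c].
Proof.
move=> oO Ox sf; have [sx_cont sx rx] := sf _ Ox.
have [A [V [r [oA As oV rV rA]]]] := local_homeomorphism_section (s x) (proj1 etaleG).
have nx : nbhs x (O `&` s @^-1` A).
  apply: filterI; first exact: open_nbhs_nbhs.
  by apply: sx_cont; exact: open_nbhs_nbhs.
have ns : nbhs (s x) (@src G @^-1` (O `&` s @^-1` A)).
  by apply: src_continuous; rewrite sx.
have nA : nbhs (s x) A by exact: open_nbhs_nbhs.
apply: filterS2 nA ns => c Ac [Oc Asc]; split=> //.
have [_ <-] := rA _ Asc; have [_ ssc _] := sf _ Oc; rewrite ssc.
by have [_] := rA _ Ac.
Qed.

Let germ_cont f x : germ f x -> {for x, continuous f}.
Proof.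
move=> [O [s [oO Ox sf]]]; have [cs _ _] := sf _ Ox.
apply: (continuous_at_near_eq (u := @rng G \o s)).
  by apply: continuous_at_comp => //; exact: rng_continuous.
by apply: filterS (open_nbhs_nbhs (conj oO Ox)) => y /sf[].
Qed.

(** Near [f x] the range map has a section [r] through [s x]. Its values close to [s x] lie on the
    section [s], so their sources are preimages under [f]. *)
Let germ_open f x N : germ f x -> nbhs x N -> nbhs (f x) (f @` N).
Proof.
move=> [O [s [oO Ox sf]]] Nx; have [cs sx rx] := sf _ Ox.
have [A [V [r [oA As oV rV rA]]]] := local_homeomorphism_section (s x) (proj2 etaleG).
have ns := local_section_near oO Ox sf.
have ns' : nbhs (s x) (@src G @^-1` N) by apply: src_continuous; rewrite sx.
have [Vsx rsx] := rA _ As; have [cr _ _] := rV _ Vsx.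
have nr : nbhs (rng (s x)) (r @^-1` ([set c | O (src c) /\ s (src c) = c] `&`
    @src G @^-1` N)).
  by apply: cr; rewrite rsx; exact: filterI.
rewrite -rx; apply: filterS2 (open_nbhs_nbhs (conj oV Vsx)) nr.
move=> z Vz [[Oz sz] Nz]; exists (src (r z)) => //.
by have [_ _ <-] := sf _ Oz; rewrite sz; have [] := rV _ Vz.
Qed.

Let germ_comp' f g x : germ f x -> germ g (f x) -> germ (g \o f) x.
Proof.
move=> fx [O' [s' [oO' Ox' sg]]]; have cf := germ_cont fx.
have [O [s [oO Ox sf]]] := fx.
have n : nbhs x (O `&` f @^-1` O').
  apply: filterI; first exact: open_nbhs_nbhs.
  by apply: cf; exact: open_nbhs_nbhs.
move: n; rewrite nbhsE => -[Q [oQ Qx] QO].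
exists Q, (fun y => gmul (s' (f y)) (s y)); split=> // y Qy.
have [Oy Oy'] := QO _ Qy.
have comp z : Q z -> gdom (s' (f z)) = gcod (s z).
  move=> /QO[Oz Oz']; have [_ _ rz] := sf _ Oz; have [_ sz _] := sg _ Oz'.
  by rewrite -[gdom _]/(\val (src (s' (f z)))) sz -rz.
have [cs sy ry] := sf _ Oy; have [cs' sy' ry'] := sg _ Oy'; split.
- apply: gmul_continuous_at => //.
    apply: continuous_at_comp => //; apply: germ_cont.
    by exists O, s.
  by apply: filterS (open_nbhs_nbhs (conj oQ Qy)) => z; exact: comp.
- by rewrite -[RHS]sy; apply: val_inj; rewrite /= gdom_mul // comp.
- by rewrite -[RHS]ry'; apply: val_inj; rewrite /= gcod_mul // comp.
Qed.

Lemma germ_groupoid_axioms : germ_axioms germ.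
Proof.
split.
- move=> x; exists setT, (fun y => \val y); split=> //; first exact: openT.
  move=> y _; split; first exact: set_type_val_continuous.
    by apply: val_inj; rewrite /= unit_gdom.
  by apply: val_inj; rewrite /= unit_gcod.
- exact: germ_comp'.
- move=> f g x [O [s [oO Ox sf]]] fg.
  have n : nbhs x (O `&` [set y | f y = g y]).
    by apply: filterI => //; exact: open_nbhs_nbhs.
  move: n; rewrite nbhsE => -[Q [oQ Qx] QO].
  exists Q, s; split=> // y /QO[Oy /= <-]; exact: sf.
- exact: germ_cont.
- exact: germ_open.
- move=> f x fx; have [O [s [oO Ox sf]]] := fx.
  have [A [V [r [oA As oV rV rA]]]] := local_homeomorphism_section (s x) (proj2 etaleG).
  have [cs _ _] := sf _ Ox.
  have n : nbhs x (O `&` s @^-1` A).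
    apply: filterI; first exact: open_nbhs_nbhs.
    by apply: cs; exact: open_nbhs_nbhs.
  move: n; rewrite nbhsE => -[Q [oQ Qx] QO]; exists Q; split=> //.
    by move=> y /QO[Oy _]; exists O, s.
  move=> y z /QO[Oy Ay] /QO[Oz Az] fyz.
  have [_ sy ry] := sf _ Oy; have [_ sz rz] := sf _ Oz.
  have [_ ey] := rA _ Ay; have [_ ez] := rA _ Az.
  by rewrite -sy -sz -ey -ez ry rz fyz.
- move=> U f g oU Uf gf x Ux; have [O [s [oO Ox sf]]] := Uf _ Ux.
  have nOU y : O y -> U y -> nbhs y (O `&` U).
    by move=> Oy Uy; apply: filterI; exact: open_nbhs_nbhs.
  (* Inverse arrows give a section for [g]; it is continuous at [f y] because [f] carries
     neighbourhoods of [y] to neighbourhoods of [f y]. *)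
  exists (f @` (O `&` U)), (fun z => ginv (s (g z))); split.
  + rewrite openE => _ [y [Oy Uy] <-]; apply: germ_open; [exact: Uf|exact: nOU].
  + by exists x.
  + move=> _ [y [Oy Uy] <-]; rewrite gf //; have [cs sy ry] := sf _ Oy; split.
    * apply: (continuous_at_comp (u := fun z => s (g z))); last exact: ginv_continuous.
      apply: (continuous_at_comp (u := g)); last by rewrite gf.
      move=> N; rewrite gf // => Ny.
      have : nbhs (f y) (f @` (N `&` (O `&` U))).
        by apply: germ_open; [exact: Uf|apply: filterI => //; exact: nOU].
      have sub : f @` (N `&` (O `&` U)) `<=` g @^-1` N.
        by move=> _ [z [Nz [_ Uz]] <-]; rewrite /preimage /= gf.
      by move=> /(filterS sub).
    * by rewrite -[RHS]ry; apply: val_inj; rewrite /= gdom_inv.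
    * by rewrite -[RHS]sy; apply: val_inj; rewrite /= gcod_inv.
Qed.

(** * Translating the hypotheses on the groupoid into germs *)

Section CantorUnits.
Hypothesis cantorG : cantor_groupoid G.

Lemma cantor_units : [/\ compact [set: X], hausdorff_space X, clopen_basis X &
  exists x : X, True].
Proof.
have [h] := cantorG; have hc := @homeo_fun_continuous _ _ h.
have hi : injective h by exact: can_inj (homeo_funK h).
have cX : compact [set: X].
  have -> : [set: X] = homeo_inv h @` [set: cantor_space].
    by apply/seteqP; split=> // x _; exists (h x) => //; rewrite homeo_funK.
  apply: continuous_compact; last exact: cantor_space_compact.
  by apply: continuous_subspaceT; exact: homeo_inv_continuous.
have hX : hausdorff_space X.
  move=> p q pq; apply: hi; apply: cantor_space_hausdorff => A B Ap Bq.
  by have [x [Ax Bx]] := pq _ _ (hc _ _ Ap) (hc _ _ Bq); exists (h x).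
split=> //; last by exists (homeo_inv h point).
move=> x N Nx; have zX : zero_dimensional X.
  move=> y z yz; have hyz : h y != h z by apply: contra_neq yz => /hi.
  have [U [[oU cU] Uy Uz]] := cantor_zero_dimensional hyz.
  exists (h @^-1` U); split=> //; split; first by apply: open_comp => // ? _; exact: hc.
  by apply: preimage_closed => // ? _; exact: hc.
by have [D [Dx cD] DN] := zero_dimensional_cvg hX zX cX Nx; exists D.
Qed.

Let cX : compact [set: X]. Proof. by have [] := cantor_units. Qed.
Let hX : hausdorff_space X. Proof. by have [] := cantor_units. Qed.
Let basisX : clopen_basis X. Proof. by have [] := cantor_units. Qed.
Let x0P : exists x : X, True. Proof. by have [] := cantor_units. Qed.

Lemma minimal_germ : minimal G ->
  forall x N, open N -> N !=set0 -> exists f, germ f x /\ N (f x).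
Proof.
move=> mG x N oN N0; have [y [Ny [c /= cx cy]]] := mG x N N0 oN; subst.
have [A [V [r [oA Ac oV rV rA]]]] := local_homeomorphism_section c (proj1 etaleG).
have [Vc rc] := rA _ Ac.
exists (@rng G \o r); rewrite /= rc; split=> //.
by exists V, r; split=> // y /rV[].
Qed.

Lemma bisection_section (B : set G) : compact_open_bisection B ->
  exists r : X -> G, [/\ clopen (@src G @` B),
    forall z, (@src G @` B) z -> [/\ {for z, continuous r}, B (r z) & src (r z) = z],
    forall c, B c -> r (src c) = c &
    forall c d, B c -> B d -> rng c = rng d -> c = d].
Proof.
move=> [cB [oB [V oV sB] [V' oV' rB]]]; have [x0 _] := x0P.
have [r [rV rA]] := restricts_to_homeo_section (\val x0) oV sB.
have [r' [_ rA']] := restricts_to_homeo_section (\val x0) oV' rB.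
have VE : @src G @` B = V.
  by apply/seteqP; split=> [_ [c /rA[? _] <-]|z /rV[_ Bz <-]] //; exists (r z).
exists r; rewrite VE; split=> //.
- split=> //; rewrite -VE; apply: compact_closed => //.
  apply: continuous_compact => //; apply: continuous_subspaceT.
  exact: src_continuous.
- by move=> c /rA[].
- by move=> c d /rA'[_ {2}<-] /rA'[_ {2}<-] ->.
Qed.

Lemma bisection_iso (B : set G) : compact_open_bisection B ->
  exists f, iso germ (@src G @` B) f /\ forall c, B c -> f (src c) = rng c.
Proof.
move=> /bisection_section[r [cB rV rA rI]]; exists (@rng G \o r); split.
  split=> // [x y /rV[_ Bx sx] /rV[_ By sy] /= /rI|x Bx].
    by move=> e; rewrite -sx -sy e.
  by exists (@src G @` B), r; split=> //; [case: cB|move=> y /rV[]].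
by move=> c Bc /=; rewrite rA.
Qed.

Lemma infinite_germ : purely_infinite G -> forall N, clopen N -> exists f g,
  [/\ iso germ N f, iso germ N g, forall x, N x -> N (f x), forall x, N x -> N (g x) &
      forall x y, N x -> N y -> f x <> g y].
Proof.
move=> piG N cN; have [B [B' [[cB cB'] [sB sB'] BB0 rB rB']]] :=
  piG N (clopen_compact cX cN) (proj1 cN).
have [f [If fB]] := bisection_iso cB; have [g [Ig gB]] := bisection_iso cB'.
rewrite sB in If; rewrite sB' in Ig.
have fr x : N x -> (@rng G @` B) (f x).
  by rewrite -{1}sB => -[c Bc <-]; rewrite fB //; exists c.
have gr x : N x -> (@rng G @` B') (g x).
  by rewrite -{1}sB' => -[c Bc <-]; rewrite gB //; exists c.
exists f, g; split=> //; [by move=> x /fr/rB|by move=> x /gr/rB'|].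
move=> x y /fr fx /gr gy fg; rewrite fg in fx.
by rewrite -[False]/(set0 (g y)) -BB0; split.
Qed.

Lemma src_open (B : set G) : open B -> open (@src G @` B).
Proof.
move=> oB; rewrite openE => _ [c Bc <-].
have [A [V [r [oA Ac oV rV rA]]]] := local_homeomorphism_section c (proj1 etaleG).
have [Vc rc] := rA _ Ac; have [cr _ _] := rV _ Vc.
have nB : nbhs (src c) (r @^-1` B) by apply: cr; rewrite rc; exact: open_nbhs_nbhs.
apply: filterS2 (open_nbhs_nbhs (conj oV Vc)) nB => z Vz Bz.
by exists (r z) => //; have [] := rV _ Vz.
Qed.

(** The members of [F] and their inverses become partial maps, and [None] stands for the identity. A
    basic set around an arrow, chosen inside the image of a section, is a product of bisections,
    hence gives a word that agrees with [s] on the sources. *)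
Lemma expansive_germ : expansive G ->
  exists (J : finType) (D : J -> set X) (b : J -> X -> X) (j0 : J),
  [/\ forall j, iso germ (D j) (b j), D j0 = setT, b j0 = id &
    forall N (s : X -> X) x, open N -> N x -> (forall y, N y -> germ s y) ->
    exists V w, [/\ word D b V w, open V, V x, V `<=` N & forall y, V y -> w y = s y]].
Proof.
move=> [_ [F [_ finF FB _ [Fo Fb]]]].
pose F' := F `|` (@set_inv G @` F).
have finF' : finite_set F' by rewrite finite_setU; split=> //; exact: finite_image.
have isoF (C : set G) : exists f : X -> X, F' C -> iso germ (@src G @` C) f /\
    forall c, C c -> f (src c) = rng c.
  have [[FC|[B FB' <-]]|nF] := pselect (F' C); last by exists id.
    by have [f fC] := bisection_iso (FB _ FC); exists f.
  have [f [If fB]] := bisection_iso (FB _ FB').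
  have [g Ig gf] := iso_inverse germ_groupoid_axioms cX hX If.
  exists g => _; have sr (c : G) : src (ginv c) = rng c.
    by apply: val_inj; rewrite /= gdom_inv.
  have rs (c : G) : rng (ginv c) = src c by apply: val_inj; rewrite /= gcod_inv.
  split.
    rewrite (_ : @src G @` _ = f @` (@src G @` B)) //.
    apply/seteqP; split=> [_ [_ [c Bc <-] <-]|_ [_ [c Bc <-] <-]].
      by exists (src c); [exists c|rewrite sr fB].
    by exists (ginv c); [exists c|rewrite sr fB].
  by move=> _ [c Bc <-]; rewrite sr rs -fB // gf //; exists c.
have [bf bfP] := choice isoF.
have /finite_seqP[l lE] := finF'.
have lF (i : 'I_(size l)) : F' (nth set0 l i) by rewrite lE /=; exact: mem_nth.
pose D (j : option 'I_(size l)) := if j is Some i then @src G @` nth set0 l i else setT.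
pose b (j : option 'I_(size l)) := if j is Some i then bf (nth set0 l i) else id.
exists (option 'I_(size l)), D, b, None; split=> //.
  case=> [i|] /=; first by have [] := bfP _ (lF i).
  by apply: (iso_id germ_groupoid_axioms); exact: clopenT.
have powP n B : family_pow F' n B -> exists w, word D b (@src G @` B) w /\
    forall c, B c -> w (src c) = rng c.
  elim: n B => [B ->|n IH _ [A FA [B /IH[w [wB wE]] <-]]].
    exists id; have su x : src (\val x) = x by apply: val_inj; rewrite /= unit_gdom.
    split.
      rewrite (_ : @src G @` _ = setT); first exact: word_nil.
      apply/seteqP; split=> // x _; exists (\val x) => //; exact: set_valP.
    by move=> _ [c _ <-]; apply: val_inj; rewrite /= gdom_dom gcod_dom.
  have [i iA] : exists i : 'I_(size l), nth set0 l i = A.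
    have Al : A \in l by move: FA; rewrite lE.
    by have li := Al; rewrite -index_mem in li; exists (Ordinal li); exact: nth_index.
  have [_ bA] := bfP _ (lF i); rewrite iA in bA.
  have smul (c d : G) : gdom c = gcod d -> src (gmul c d) = src d.
    by move=> cd; apply: val_inj; rewrite /= gdom_mul.
  have rmul (c d : G) : gdom c = gcod d -> rng (gmul c d) = rng c.
    by move=> cd; apply: val_inj; rewrite /= gcod_mul.
  have cdE (c d : G) : gdom c = gcod d -> src c = rng d by move=> ?; exact: val_inj.
  exists (b (Some i) \o w); split.
    rewrite (_ : @src G @` _ = (@src G @` B) `&` w @^-1` D (Some i)).
      exact: word_cons.
    apply/seteqP; split=> [_ [_ [c [d [Ac Bd cd ->]]] <-]|_ [[d Bd <-]]].
      rewrite smul //; split; first by exists d.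
      by rewrite /preimage /= wE // -(cdE _ _ cd) iA; exists c.
    rewrite /preimage /= wE // iA => -[c Ac crd].
    have cd : gdom c = gcod d by have /(congr1 \val) := crd.
    by exists (gmul c d); [exists c, d|rewrite smul].
  move=> _ [c [d [Ac Bd cd ->]]].
  by rewrite smul // rmul //= wE // -(cdE _ _ cd) iA bA.
move=> N s x oN Nx gs; have [O [t [oO Ox ts]]] := gs _ Nx.
have nt := local_section_near oO Ox ts; have [_ tx _] := ts _ Ox.
have nN : nbhs (t x) (@src G @^-1` N).
  by apply: src_continuous; rewrite tx; exact: open_nbhs_nbhs.
have [B [[n _ nB] Btx] BN] := Fb _ _ (filterI nt nN).
have [w [wB wE]] := powP _ _ nB.
exists (@src G @` B), w; split=> //.
- by apply: src_open; apply: Fo; exists n.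
- by exists (t x).
- by move=> _ [c /BN[_ Nc] <-].
- move=> _ [c Bc <-]; rewrite wE //; have [[Oc tc] _] := BN _ Bc.
  by have [_ _ <-] := ts _ Oc; rewrite tc.
Qed.

(** * Comparison with the full group and the alternating group *)

Lemma section_range_homeo (p : G -> X) (t : X -> G) :
  continuous p -> continuous t -> cancel t p ->
  restricts_to_homeo p (range t) [set: X].
Proof.
move=> cp ct tp.
pose u (a : range t) : [set: X] := exist _ (p (\val a)) (mem_set I).
have tr (y : [set: X]) : t (\val y) \in range t by rewrite inE; exists (\val y).
pose v (y : [set: X]) : range t := exist _ (t (\val y)) (tr y).
have uK : cancel u v.
  case=> c ic; apply: val_inj => /=; have [y _ <-] := set_mem ic.
  by rewrite tp.
have vK : cancel v u by move=> y; apply: val_inj; rewrite /= tp.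
have cu : continuous u.
  move=> a; apply: continuous_at_set_type.
  apply: (continuous_at_comp (u := fun b : range t => \val b) (v := p)); last exact: cp.
  exact: set_type_val_continuous.
have cv : continuous v.
  move=> a; apply: continuous_at_set_type.
  apply: (continuous_at_comp (u := fun b : [set: X] => \val b) (v := t)); last exact: ct.
  exact: set_type_val_continuous.
by exists (Homeo uK vK cu cv).
Qed.

(** Local sections are patched over clopen sets, one of them taking priority on overlaps, where they
    may differ. The range of the resulting global section [s] is the bisection; it is also the range
    of [s \o gV], a section of the range map. *)
Lemma germ_full_group (g : homeo X X) : (forall x, germ g x) -> full_group G g.
Proof.
move=> gg.
pose R A := clopen A /\ exists s, local_section A s g.
have [W TW [_ [s sg]]] : exists2 W, setT `<=` W & R W.
  apply: compact_set_ind => //.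
  - by split; [exact: clopen0|exists (fun x => \val x)].
  - move=> A B [cA [s sA]] [cB [t tB]]; split; first exact: clopenU.
    pose r x := if pselect (A x) then s x else t x.
    have rA x : A x -> r x = s x by rewrite /r; case: pselect.
    have rB x : ~ A x -> r x = t x by rewrite /r; case: pselect.
    exists r => x ABx; have [Ax|nAx] := pselect (A x).
      have [cs sx rx] := sA _ Ax; rewrite rA //; split=> //.
      apply: (continuous_at_near_eq cs).
      by apply: filterS (clopen_nbhs cA Ax) => y Ay /=; rewrite rA.
    have [|ct tx rx] := tB x; first by case: ABx.
    rewrite rB //; split=> //; apply: (continuous_at_near_eq ct).
    apply: filterS (clopen_nbhs (clopenC set0 cA) nAx) => y nAy /=.
    by rewrite rB.
  - move=> x _; have [O [s [oO Ox sg]]] := gg x.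
    have [C [cC Cx CO]] := basisX (open_nbhs_nbhs (conj oO Ox)).
    exists C; split=> //; first by case: cC.
    by split=> //; exists s => y /CO; exact: sg.
have {}sg : local_section setT s g by move=> x _; exact/sg/TW.
have cs : continuous s by move=> x; have [] := sg x I.
have ss x : src (s x) = x by have [] := sg x I.
have rs x : rng (s x) = g x by have [] := sg x I.
pose gV : homeo X X := (g^-1)%g.
have gVK x : gV (g x) = x by exact: homeoVK.
have gKV x : g (gV x) = x by exact: homeoKV.
have rB : range s = range (s \o gV).
  apply/seteqP; split=> [_ [x _ <-]|_ [x _ <-]]; last by exists (gV x).
  by exists (g x); rewrite // /comp gVK.
exists (range s); split.
- split.
    apply: continuous_compact => //; exact: continuous_subspaceT.
  split.
  + rewrite openE => _ [x _ <-].
    apply: filterS (local_section_near openT I sg) => c [_ <-].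
    by exists (src c).
  + exists setT; first exact: openT.
    exact: section_range_homeo src_continuous cs ss.
  + exists setT; first exact: openT.
    rewrite rB; apply: section_range_homeo rng_continuous _ _.
      move=> x; apply: continuous_at_comp; last exact: cs.
      exact: homeo_inv_continuous.
    by move=> x; rewrite /comp rs gKV.
- by apply/seteqP; split=> // x _; exists (s x) => //; exists x.
- by apply/seteqP; split=> // x _; exists (s (gV x)); [exists (gV x)|rewrite rs gKV].
- apply: funext => x; rewrite /alpha /=.
  set c := 'pinv_ _ _ _ _.
  have xr : x \in @src G @` range s by rewrite inE; exists (s x) => //; exists x.
  have sc : src c = x by exact: pinvK.
  have [y _ yc] : (range s) c.
    apply: (surjpinv_image_sub (f := @src G) (B := @src G @` range s)) => //.
    by exists x => //; exact: set_mem.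
  by rewrite -yc; move: sc; rewrite -yc ss => ->; rewrite rs.
Qed.

Lemma full_group_germ (g : homeo X X) : full_group G g -> forall x, germ g x.
Proof.
move=> [B [cB sB _ gE]] x.
have [r [_ rV rA _]] := bisection_section cB; rewrite sB in rV.
exists setT, r; split=> //; first exact: openT.
move=> y _; have [cr Br sr] := rV y I; split=> //.
rewrite gE /alpha /=; set c := 'pinv_ _ _ _ _.
have yr : y \in @src G @` B by rewrite sB inE.
have sc : src c = y by exact: pinvK.
have Bc : B c.
  apply: (surjpinv_image_sub (f := @src G) (B := @src G @` B)) => //.
  by exists y => //; exact: set_mem.
by rewrite -(rA _ Bc) sc.
Qed.

(** The first of the three sets is the base, and the three maps are the identity, [g] and its
    square; order three closes the cycle. *)
Lemma three_cycle_alternating (g : homeo X X) :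
  three_cycle g -> alternating germ g.
Proof.
move=> [gF [_ _ g3] [F [cF tF gF' gf]]]; have gg := full_group_germ gF.
have E j x : F j x -> F (ordS j) (g x) by rewrite -gF' => ?; exists x.
pose i0 : 'I_3 := ord0; pose i1 := ordS i0; pose i2 := ordS i1.
have gggx x : g (g (g x)) = x.
  by have /(congr1 (fun h : homeo X X => h x)) := g3.
have dis i j x y : i != j -> F i x -> F j y -> x <> y.
  move=> ij Fx Fy xy; move/negP: ij; apply; apply/eqP.
  by apply: (tF i j I I); exists x; split=> //; rewrite xy.
have F1 x : F i0 x -> F i1 (g x) by exact: E.
have F2 x : F i0 x -> F i2 (g (g x)) by move=> ?; exact/E/E.
have G0 : iso germ (F i0) id.
  apply: (iso_id germ_groupoid_axioms); have [cF0 oF0] := cF i0.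
  by split=> //; exact: compact_closed.
have Ig : iso germ setT g.
  by split=> //; [exact: clopenT|move=> x y _ _ /homeo_inj].
have G1 := iso_comp germ_groupoid_axioms G0 Ig (fun _ _ => I).
have G2 := iso_comp germ_groupoid_axioms G1 Ig (fun _ _ => I).
apply: (@alternating_cycle3 _ _ (F i0) id (g \o id) (g \o (g \o id))).
  split=> // x y Fx Fy; split=> //; [by move=> /homeo_inj|by move=> /homeo_inj/homeo_inj|].
  split.
  - by apply: (@dis i0 i1) => //; exact: F1.
  - by apply: (@dis i0 i2) => //; exact: F2.
  - by apply: (@dis i1 i2) => //; [exact: F1|exact: F2].
split=> // [x _|y yF]; first exact: gggx.
apply: gf => -[[[|[|[|//]]] lt3] _ Fy].
- have [|] := yF y => //; first by rewrite (_ : i0 = Ordinal lt3) //; exact: val_inj.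
- have [x Fx xy] : (g @` F i0) y.
    by rewrite gF' (_ : ordS i0 = Ordinal lt3) //; exact: val_inj.
  by have [_] := yF x Fx; case; rewrite -xy.
- have [z Fz zy] : (g @` F i1) y.
    by rewrite gF' (_ : ordS i1 = Ordinal lt3) //; exact: val_inj.
  have [x Fx xz] : (g @` F i0) z by rewrite gF'.
  by have [_ _] := yF x Fx; case; rewrite -zy -xz.
Qed.

(** A point of [U] witnesses that [g] and its square are nontrivial; over an empty base the cycle is
    the identity. *)
Lemma cycle3_three_cycle U f0 f1 f2 (g : homeo X X) : U !=set0 ->
  triple germ U f0 f1 f2 -> is_cycle3 U f0 f1 f2 g -> three_cycle g.
Proof.
move=> [x0 Ux0] t gc; have [g0 g1 g2 gf] := gc.
have gg x : germ g x.
  have [k kc kg] := cycle3_exists germ_groupoid_axioms cX hX t.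
  by rewrite (is_cycle3_uniq gc kc).
have [I0 I1 I2 sep] := t.
have [_ _ _ [n01 n02 n12]] := sep _ _ Ux0 Ux0.
split; first exact: germ_full_group.
  split.
  - by apply/eqP => g1E; apply: n01; rewrite -g0 // g1E.
  - apply/eqP => /(congr1 (fun h : homeo X X => h (f0 x0))).
    by rewrite expg2 homeoM g0 // g1 // => /esym.
  - apply: homeo_ext => y; rewrite !expgS expg0 mulg1 !homeoM.
    have [[x [Ux [->|->|->]]]|yU] := support_cases U f0 f1 f2 y.
    + by rewrite g0 // g1 // g2.
    + by rewrite g1 // g2 // g0.
    + by rewrite g2 // g0 // g1.
    by rewrite !gf.
pose F (j : 'I_3) := nth f0 [:: f0; f1; f2] j @` U.
have cF j : clopen (F j).
  have c f : iso germ U f -> clopen (f @` U).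
    exact: (iso_image_clopen germ_groupoid_axioms cX hX).
  by case: j => [[|[|[|//]]] lt3]; exact: c.
exists F; split.
- by move=> j; split; [exact: (clopen_compact cX)|case: (cF j)].
- move=> [[|[|[|//]]] i] [[|[|[|//]]] j] _ _ [y [[x Ux <-] [z Uz /= E]]];
    apply/val_inj => //=; have [_ _ _ [a b c]] := sep _ _ Ux Uz;
    have [_ _ _ [a' b' c']] := sep _ _ Uz Ux; by have /esym := E.
- case=> [[|[|[|//]]] lt3]; apply/seteqP; split=> [_ [_ [x Ux <-] <-]|_ [x Ux <-]] /=.
  + by exists x => //; rewrite g0.
  + by exists (f0 x); [exists x|rewrite g0].
  + by exists x => //; rewrite g1.
  + by exists (f1 x); [exists x|rewrite g1].
  + by exists x => //; rewrite g2.
  + by exists (f2 x); [exists x|rewrite g2].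
- move=> y nF; apply: gf => x Ux.
  split=> yE; apply: nF; rewrite yE.
  + by exists ord0 => //; exists x.
  + by exists (@Ordinal 3 1 isT) => //; exists x.
  + by exists (@Ordinal 3 2 isT) => //; exists x.
Qed.

Lemma alternating_groupE : alternating_group G = alternating germ.
Proof.
have sA := @subgroup_gen_subgroup _ (@three_cycle G).
apply/seteqP; split=> g gA.
  apply: (gA (alternating germ)); split; first exact: alternating_subgroup.
  exact: three_cycle_alternating.
apply: (gA (alternating_group G)); split; first exact: sA.
move=> h [U [f0 [f1 [f2 [t hc]]]]].
have [U0|U0] := pselect (U !=set0).
  by move=> M [_]; apply; exact: cycle3_three_cycle U0 t hc.
have -> : h = 1; last exact: (subgroup1 sA).
apply: homeo_ext => x; have [_ _ _] := hc; apply=> y Uy.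
by case: U0; exists y.
Qed.

End CantorUnits.
End Germ.

Theorem corollaryC (G : topologicalGroupoidType)
  (hausdorffG : hausdorff_space G)
  (etaleG : etale G)
  (cantorG : cantor_groupoid G)
  (minimalG : minimal G)
  (expansiveG : expansive G)
  (purely_infiniteG : purely_infinite G)
  (essentially_principalG : essentially_principal G) :
  two_generated (alternating_group G).
Proof.
have [cX hX basisX [x0 _]] := cantor_units cantorG.
have [J [D [b [j0 [Db D0 b0 expD]]]]] := expansive_germ etaleG cantorG expansiveG.
rewrite (alternating_groupE etaleG cantorG).
exact: (alternating_two_generated (germ_groupoid_axioms etaleG) cX hX basisX
  (minimal_germ etaleG minimalG) (infinite_germ cantorG purely_infiniteG)
  Db D0 b0 expD x0).
Qed.
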